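(* Let $\Bbbk$ be a field, $Q=\Bbbk[t_1,\ldots,t_s]$ and $$J=(t_i t_j \mid 1 \leq i < j-1 \leq s-1).$$ Then, for $i\ge2$, the $(i-1)$-st free module in a minimal $\mathbb N^s$-graded free resolution of $Q/J$ is $$F_{i-1}=\bigoplus_{A\subseteq \{1,\ldots,s\},\ |A|=i} Q\Bigl(-\prod_{j\in A} t_j\Bigr)^{\operatorname{gap}(A)}.$$ In particular, if $\deg(t_i)=d_i$ for positive integers $d_1,\ldots,d_s$, then the Hilbert series of $Q/J$ is $$\operatorname{HS}(t,Q/J)=\frac{1+\sum_{A\subseteq \{1,\ldots,s\}}(-1)^{|A|+1}\operatorname{gap}(A)\,t^{\sum_{k\in A}d_k}}{\prod_{j=1}^s(1-t^{d_j})}.$$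
   Context: For $A=\{b_1<\cdots<b_i\}\subseteq\{1,\ldots,s\}$, the gap number is $\operatorname{gap}(A)=|\{\ell \mid 1\le\ell<i,\ b_{\ell+1}-b_\ell>1\}|$, with $\operatorname{gap}(\emptyset)=0$. For a monomial $m$, $Q(-m)$ denotes the free $Q$-module of rank one with generator in the $\mathbb N^s$-degree of $m$ (the exponent vector of $m$). *)

(* Defs.v *)
From HB Require Import structures.
From mathcomp Require Import all_boot all_order all_algebra.
From mathcomp Require Import boolp.
From mathcomp Require Import mpoly.

Set Implicit Arguments.
Unset Strict Implicit.
Unset Printing Implicit Defensive.

Import GRing.Theory.
Local Open Scope ring_scope.

(* The exponent vector of a monomial lives in ['X_{1..n}], the monoid N^n.    *)

Section GradedFreeModules.
Variables (k : fieldType) (n : nat).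
Local Notation Q := {mpoly k[n]}.

(* The N^n-graded free module \bigoplus_(e : gf_idx) Q(- gf_deg e).           *)
Record gfree := GFree { gf_idx : finType; gf_deg : gf_idx -> 'X_{1..n} }.

(* [Q^o] is Q as a module over itself ([Q] alone is a module over [k]).       *)
Definition gf_mod (F : gfree) : lmodType Q := {ffun gf_idx F -> Q^o}.

(* An element of Q(-a) has degree b when its monomials c satisfy c + a = b.   *)
Definition gf_homog (F : gfree) (b : 'X_{1..n}) (v : gf_mod F) : Prop :=
  forall (e : gf_idx F) (c : 'X_{1..n}),
    c \in msupp (v e : Q) -> (c + gf_deg e)%MM = b.

Definition gf_twist (a : 'X_{1..n}) : gfree := GFree (fun _ : unit => a).

Definition gf_sum (T : finType) (F : T -> gfree) : gfree :=
  @GFree {t : T & gf_idx (F t)} (fun e => gf_deg (tagged e)).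

Definition gf_pow (F : gfree) (r : nat) : gfree := gf_sum (fun _ : 'I_r => F).

Definition gf_iso (F G : gfree) : Prop :=
  exists2 f : {linear gf_mod F -> gf_mod G},
    bijective f & forall b v, gf_homog b v <-> gf_homog b (f v).

(* [v] lies in (t_1, ..., t_n) F.                                             *)
Definition in_max_smul (F : gfree) (v : gf_mod F) : Prop :=
  exists w : 'I_n -> gf_mod F, v = \sum_(i < n) ('X_i : Q) *: w i.

(* N^n-graded free resolutions of the Q-module [M] whose component of degree  *)
(* [b] is [gr b].                                                             *)
Record gresolution (M : lmodType Q) (gr : 'X_{1..n} -> M -> Prop) :=
  GResolution {
    res_mod : nat -> gfree;
    res_d : forall p, {linear gf_mod (res_mod p.+1) -> gf_mod (res_mod p)};
    res_aug : {linear gf_mod (res_mod 0) -> M};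
    res_d_homog : forall p b v, gf_homog b v -> gf_homog b (res_d p v);
    res_aug_homog : forall b v, gf_homog b v -> gr b (res_aug v);
    res_exact : forall p v,
      res_d p v = 0 <-> exists w, res_d p.+1 w = v;
    res_exact0 : forall v, res_aug v = 0 <-> exists w, res_d 0 w = v;
    res_aug_surj : forall x, exists v, res_aug v = x
  }.

Definition minimal_resolution (M : lmodType Q) (gr : 'X_{1..n} -> M -> Prop)
    (F : gresolution gr) : Prop :=
  forall p v, in_max_smul (res_d F p v).

(* The subspace [S] of [M] has dimension [d] over [k]; [k] acts through the   *)
(* constants of Q.                                                            *)
Definition has_kdim (M : lmodType Q) (S : M -> Prop) (d : nat) : Prop :=
  exists b : 'I_d -> M,
    [/\ forall i, S (b i),
        forall x, S x ->
          exists c : 'I_d -> k, x = \sum_(i < d) (c i)%:MP *: b i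
      & forall c : 'I_d -> k,
          \sum_(i < d) (c i)%:MP *: b i = 0 -> forall i, c i = 0].

End GradedFreeModules.

Section IdealQuotient.
Variables (R : comNzRingType) (S : R -> Prop).

Definition ideal_gen : {pred R^o} := fun p =>
  `[< exists r (c g : 'I_r -> R),
        (forall i, S (g i)) /\ p = \sum_(i < r) c i * g i >].

Fact ideal_gen_closed : submod_closed ideal_gen.
Proof.
split=> [|a p q].
  apply/asboolP; exists 0%N, (fun=> 0), (fun=> 0).
  by split=> [[]|] //; rewrite big_ord0.
move=> /asboolP [r1 [c1 [g1 [S1 ->]]]] /asboolP [r2 [c2 [g2 [S2 ->]]]].
apply/asboolP; exists (r1 + r2)%N.
exists (fun i => match split i with inl j => a * c1 j | inr j => c2 j end).
exists (fun i => match split i with inl j => g1 j | inr j => g2 j end).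
split=> [i|]; first by case: (split i).
rewrite big_split_ord /=; congr (_ + _).
  rewrite scaler_sumr; apply: eq_bigr => i _.
  by rewrite (unsplitK (inl i)) -mulrA.
by apply: eq_bigr => i _; rewrite (unsplitK (inr i)).
Qed.

HB.instance Definition _ :=
  GRing.isZmodClosed.Build R^o ideal_gen (GRing.submod_closedB ideal_gen_closed).

(* The R-module R / (S).                                                      *)
Definition ideal_quotient : Type := Quotient.quot (ideal_gen : zmodClosed R^o).

HB.instance Definition _ := EqQuotient.on ideal_quotient.
HB.instance Definition _ := GRing.Zmodule.on ideal_quotient.

Definition quot_proj (p : R) : ideal_quotient := \pi_ideal_quotient%qT (p : R^o).

Lemma quot_projE (p q : R) :
  quot_proj p = quot_proj q <-> ((p - q : R^o) \in ideal_gen).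
Proof.
rewrite (Quotient.idealrBE (ideal_gen : zmodClosed R^o)).
by split=> /eqP.
Qed.

Lemma quot_proj_surj (x : ideal_quotient) : exists p, quot_proj p = x.
Proof. by exists (repr x); exact: reprK. Qed.

Lemma quot_projD : {morph quot_proj : p q / p + q}.
Proof. exact: Quotient.pi_add. Qed.

Definition quot_scale (a : R) (x : ideal_quotient) : ideal_quotient :=
  quot_proj (a * repr x).

Lemma quot_scaleE a p : quot_scale a (quot_proj p) = quot_proj (a * p).
Proof.
apply/quot_projE; rewrite -mulrBr.
have : ((repr (quot_proj p) - p : R^o) \in ideal_gen).
  by apply/quot_projE; exact: reprK.
move=> h; have [_ cl] := ideal_gen_closed.
by rewrite -[_ * _]addr0; apply: (cl a) => //; case: ideal_gen_closed.
Qed.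

Fact quot_scalerA a b x : quot_scale a (quot_scale b x) = quot_scale (a * b) x.
Proof. by have [p <-] := quot_proj_surj x; rewrite !quot_scaleE mulrA. Qed.

Fact quot_scale1r : left_id 1 quot_scale.
Proof. by move=> x; have [p <-] := quot_proj_surj x; rewrite quot_scaleE mul1r. Qed.

Fact quot_scalerDr : right_distributive quot_scale +%R.
Proof.
move=> a x y; have [p <-] := quot_proj_surj x; have [q <-] := quot_proj_surj y.
by rewrite -quot_projD !quot_scaleE mulrDr quot_projD.
Qed.

Fact quot_scalerDl x : {morph quot_scale^~ x : a b / a + b}.
Proof.
move=> a b; have [p <-] := quot_proj_surj x.
by rewrite !quot_scaleE mulrDl quot_projD.
Qed.

HB.instance Definition _ := GRing.Zmodule_isLmodule.Build R ideal_quotient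
  quot_scalerA quot_scale1r quot_scalerDr quot_scalerDl.

End IdealQuotient.

Section PowerSeries.
Variable R : comUnitRingType.

(* [f m] is the coefficient of t^m.                                           *)
Definition fps := nat -> R.

Definition fps_poly (p : {poly R}) : fps := fun m => p`_m.

Definition fps_mul (f g : fps) : fps :=
  fun m => \sum_(i < m.+1) f i * g (m - i)%N.

(* The inverse of [f], for [f 0] a unit: its coefficients g satisfy           *)
(* g 0 = (f 0)^-1 and g m = - (f 0)^-1 * \sum_(i < m) f (m - i) * g i.        *)
Definition fps_inv_prefix (f : fps) (m : nat) : seq R :=
  iter m (fun g => rcons g
    (- (f 0%N)^-1 * \sum_(i < size g) f (size g - i)%N * g`_i)) [:: (f 0%N)^-1].

Definition fps_inv (f : fps) : fps := fun m => (fps_inv_prefix f m)`_m.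

Definition fps_div (f g : fps) : fps := fps_mul f (fps_inv g).

Lemma fps_mulVf f : f 0%N \is a GRing.unit ->
  fps_mul f (fps_inv f) =1 fps_poly 1.
Proof.
move=> uf.
have sz m : size (fps_inv_prefix f m) = m.+1.
  by elim: m => //= m IH; rewrite size_rcons IH.
have nthE m i : (i <= m)%N -> (fps_inv_prefix f m)`_i = fps_inv f i.
  elim: m => [|m IH]; first by rewrite leqn0 => /eqP ->.
  rewrite leq_eqVlt => /orP [/eqP -> //|lim].
  by rewrite /= nth_rcons sz lim IH.
case=> [|m]; rewrite /fps_mul /fps_poly coef1.
  by rewrite big_ord_recl big_ord0 addr0 /fps_inv /= divrr.
rewrite big_ord_recl /= subn0.
have -> : fps_inv f m.+1 =
    - (f 0%N)^-1 * \sum_(i < m.+1) f (m.+1 - i)%N * fps_inv f i.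
  rewrite {1}/fps_inv /= nth_rcons sz ltnn eqxx; congr (_ * _).
  by apply: eq_bigr => i _; rewrite nthE // -ltnS.
rewrite mulrA mulrN divrr // mulN1r; apply/eqP; rewrite addrC subr_eq0; apply/eqP.
rewrite (reindex_inj rev_ord_inj) /=; apply: eq_bigr => i _.
have lei : (i <= m)%N by rewrite -ltnS.
rewrite /bump /= add1n !subSS -subSn ?leq_subr //.
by rewrite subKn.
Qed.

End PowerSeries.

(* [enum A] lists [A] in increasing order.  Indices are shifted to start at 0 *)
(* both in [A] and in its enumeration b_0 < ... < b_(#|A| - 1).               *)
Definition gap (s : nat) (A : {set 'I_s}) : nat :=
  let b := [seq val j | j <- enum A] in
  #|[set l : 'I_(#|A|.-1) | (1 < nth 0 b l.+1 - nth 0 b l)%N]|.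

Definition set_mnm (s : nat) (A : {set 'I_s}) : 'X_{1..s} :=
  (\sum_(j in A) U_(j))%MM.

Section PathIdeal.
Variables (k : fieldType) (s : nat).
Local Notation Q := {mpoly k[s]}.

Definition J_generator (q : Q) : Prop :=
  exists i j : 'I_s, (i.+1 < j)%N /\ q = 'X_i * 'X_j.

Definition QJ : lmodType Q := ideal_quotient J_generator.

Definition QJ_homog (b : 'X_{1..s}) (x : QJ) : Prop :=
  exists2 p : Q, (forall c, c \in msupp p -> c = b) &
    x = quot_proj J_generator p.

(* Degree-[m] component of Q/J for the N-grading with deg(t_j) = d j.         *)
Definition QJ_whomog (d : 'I_s -> nat) (m : nat) (x : QJ) : Prop :=
  exists2 p : Q, (forall c, c \in msupp p -> (\sum_(j < s) c j * d j)%N = m) &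
    x = quot_proj J_generator p.

Definition is_hilbert_series (M : lmodType Q) (gr : nat -> M -> Prop)
    (f : fps int) : Prop :=
  forall m, exists2 h : nat, has_kdim (gr m) h & f m = h%:Z.

End PathIdeal.

(* Main.v *)
From HB Require Import structures.
Require Import Defs.
From mathcomp Require Import all_boot all_order all_algebra.
From mathcomp Require boolp.
From mathcomp Require Import mpoly.

(* In a minimal N^s-graded resolution of a monomial quotient Q/J the          *)
(* differentials are scalar matrices up to monomials, so the resolution is    *)
(* governed by finite-dimensional linear algebra in each degree ([frame]).    *)
(* For a set T of variables put Tor(T) = Tor(Q/J, Q/(t_j : j in T)); adding   *)
(* one variable to T gives a long exact sequence, and Tor_p(T)_b = 0 for T    *)
(* the support of b means that F_p has no generator of degree b.  Removing    *)
(* variables from T in a well-chosen order shows that Tor_p(T)_b vanishes for *)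
(* b not squarefree and for b = t^A with p + 2 <= |A|; minimality gives the   *)
(* opposite bound, so the resolution is linear: a generator of F_p, p >= 1,   *)
(* has degree t^A with |A| = p + 1.  The number of generators of degree t^A   *)
(* is then an Euler characteristic, determined by Moebius inversion from      *)
(*   \sum_(B \subset A) kappa B = [t^A is not in J],                          *)
(* where kappa B = (-1)^(|B|+1) gap B for B nonempty and kappa set0 = 1.  The *)
(* same identity, summed over the monomials of given weight, is the formula   *)
(* for the Hilbert series.                                                    *)

(** Nonzero entries of a minimal differential strictly raise the degree, so a generator of degree b
    never occurs in the boundary of an element of degree b. Hence ([no_gen]) such a generator of F_p
    is detected by Tor_p(T)_b, with T the support of b. By [rel_exact_chase], Tor_(p+1)(T + j)_b
    vanishes once Tor_(p+1)(T)_b and Tor_p(T)_(b - e_j) do. If b_j > 1, all variables but t_j are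
    removed from T, and squarefreeness of J settles the rest ([rel_exact_ge2]). For b = t^A, first
    the maximum v of A is removed, then minima u; while another element lies between u and v, the
    product t_u t_v is in J and one of the two terms vanishes ([rel_exact_nonface],
    [rel_exact_setU1], [rel_exact_full]). With [gen_mdeg] this gives linearity, [gen_deg]. The
    strand of degree b is an exact complex of vector spaces ([euler_below]). By linearity only one
    F_p has generators of degree t^A, so their number, up to sign, satisfies the recursion that
    [sum_kappa] proves for [kappa]; this is [gen_count]. Numbers of generators determine a graded
    free module ([gf_iso_fibers]). For the Hilbert series, [fps_mul_wcount] turns multiplication by
    a numerator into subset sums over supports of monomials. *)

Set Implicit Arguments.
Unset Strict Implicit.
Unset Printing Implicit Defensive.

Import GRing.Theory Num.Theory.
Local Open Scope ring_scope.

(** * Minimal frames of monomial quotients *)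

(* A minimal free resolution of the span of the monomials satisfying [face],  *)
(* as a quotient of Q: a generator e of F_(p+1) is sent to the sum over the   *)
(* generators e' of F_p of coef e e' t^(gdeg e - gdeg e') e', and a generator *)
(* e of F_0 to augc e t^(gdeg e).  The elements of F_p of degree b are the    *)
(* scalar vectors supported on the generators of degree at most b.            *)
Record frame (k : fieldType) (s : nat) (face : pred 'X_{1..s}) := Frame {
  gen : nat -> finType;
  gdeg : forall p, gen p -> 'X_{1..s};
  coef : forall p, gen p.+1 -> gen p -> k;
  augc : gen 0 -> k;
  coef_lt : forall p (e : gen p.+1) (e' : gen p), coef e e' != 0 ->
    (gdeg e' <= gdeg e)%MM && (gdeg e' != gdeg e);
  coef_coef : forall p (e : gen p.+2) (e2 : gen p),
    \sum_e1 coef e e1 * coef e1 e2 = 0;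
  coef_augc : forall e : gen 1, face (gdeg e) ->
    \sum_e1 coef e e1 * augc e1 = 0;
  coef_exact : forall p (b : 'X_{1..s}) (v : gen p.+1 -> k),
    (forall e, v e != 0 -> (gdeg e <= b)%MM) ->
    (forall e', \sum_e v e * coef e e' = 0) ->
    exists2 w : gen p.+2 -> k, (forall e, w e != 0 -> (gdeg e <= b)%MM) &
      forall e, v e = \sum_e1 w e1 * coef e1 e;
  aug_exact : forall (b : 'X_{1..s}) (v : gen 0 -> k),
    (forall e, v e != 0 -> (gdeg e <= b)%MM) ->
    (face b -> \sum_e v e * augc e = 0) ->
    exists2 w : gen 1 -> k, (forall e, w e != 0 -> (gdeg e <= b)%MM) &
      forall e, v e = \sum_e1 w e1 * coef e1 e;
  aug_surj : exists2 f : gen 0 -> k, (forall e, f e != 0 -> gdeg e = 0%MM) &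
      \sum_e f e * augc e = 1
}.

Section FrameTheory.
Variables (k : fieldType) (s : nat) (face : pred 'X_{1..s}).
Hypothesis faceS : forall b c : 'X_{1..s},
  (forall j, (0 < b j)%N -> (0 < c j)%N) -> face c -> face b.
Variable G : frame k face.
Local Notation gen := (gen G).

Definition supp_le (b : 'X_{1..s}) p (v : gen p -> k) :=
  forall e, v e != 0 -> (gdeg e <= b)%MM.

Definition bd p (v : gen p.+1 -> k) (e' : gen p) : k :=
  \sum_e v e * coef e e'.

(** Out of F_0 the differential is zero, not the augmentation, as in the complex that computes
    Tor. *)
Definition bnd p : (gen p -> k) -> gen p.-1 -> k :=
  if p is q.+1 then @bd q else fun _ _ => 0.

(** For [gdeg e <= b], this says that t^(b - gdeg e) e lies in (t_j : j in T) F_p, so that it dies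
    modulo the variables in T. *)
Definition short (T : {set 'I_s}) (b : 'X_{1..s}) p (e : gen p) :=
  [exists j in T, gdeg e j < b j]%N.

(* The vanishing of Tor_p(M, Q/(t_j : j in T)) in degree b. *)
Definition rel_exact (T : {set 'I_s}) (b : 'X_{1..s}) p :=
  forall v : gen p -> k, supp_le b v ->
    (forall e', bnd v e' != 0 -> short T b e') ->
    exists2 w : gen p.+1 -> k, supp_le b w &
      forall e, v e - bd w e != 0 -> short T b e.

Definition delta p (e : gen p) : gen p -> k := fun e' => (e' == e)%:R.

Lemma bd_delta p (e : gen p.+1) e' : bd (delta e) e' = coef e e'.
Proof.
rewrite /bd (bigD1 e) //= /delta eqxx mul1r big1 ?addr0 // => i /negbTE ->.
by rewrite mul0r.
Qed.

Lemma bdB p (v w : gen p.+1 -> k) e' :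
  bd (fun e => v e - w e) e' = bd v e' - bd w e'.
Proof.
by rewrite /bd -sumrB; apply: eq_bigr => e _; rewrite mulrBl.
Qed.

Lemma bd_bd p (v : gen p.+2 -> k) e' : bd (bd v) e' = 0.
Proof.
rewrite /bd; under eq_bigr do rewrite mulr_suml.
rewrite exchange_big big1 //= => e _.
under eq_bigr do rewrite -mulrA.
by rewrite -mulr_sumr coef_coef mulr0.
Qed.

Lemma sum_neq0 (I : finType) (F : I -> k) : \sum_i F i != 0 ->
  exists i, F i != 0.
Proof.
move=> h; have [i hi|nh] := pickP (fun i => F i != 0); first by exists i.
by rewrite big1 ?eqxx // in h => i _; apply/eqP/negbFE/nh.
Qed.

Lemma bd_supp p (v : gen p.+1 -> k) e' : bd v e' != 0 ->
  exists2 e, v e != 0 & (gdeg e' <= gdeg e)%MM && (gdeg e' != gdeg e).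
Proof.
rewrite /bd => /sum_neq0 [e]; rewrite mulf_eq0 negb_or => /andP [ve ce].
by exists e => //; apply: coef_lt.
Qed.

Lemma supp_le_bd b p (v : gen p.+1 -> k) : supp_le b v -> supp_le b (bd v).
Proof.
move=> vb e' /bd_supp [e /vb eb /andP [e'e _]]; exact: lepm_trans eb.
Qed.

Lemma lepm_anti (b c : 'X_{1..s}) : (b <= c)%MM -> (c <= b)%MM -> b = c.
Proof.
move=> /mnm_lepP h1 /mnm_lepP h2; apply/mnmP => i.
by apply/eqP; rewrite eqn_leq h1 h2.
Qed.

(** This is where minimality enters: entries between generators of equal degree vanish. *)
Lemma bd_top p (e : gen p) (w : gen p.+1 -> k) :
  supp_le (gdeg e) w -> bd w e = 0.
Proof.
move=> wb; apply/eqP/negPn/negP => /bd_supp [e1 /wb h1 /andP [h2]].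
by rewrite (lepm_anti h2 h1) eqxx.
Qed.

Lemma aug_bd b (w : gen 1 -> k) : supp_le b w -> face b ->
  \sum_e bd w e * augc e = 0.
Proof.
move=> wb fb; rewrite /bd; under eq_bigr do rewrite mulr_suml.
rewrite exchange_big big1 //= => e _.
under eq_bigr do rewrite -mulrA.
rewrite -mulr_sumr; have [->|ne] := eqVneq (w e) 0; first by rewrite mul0r.
rewrite coef_augc ?mulr0 //; apply: faceS fb => j.
by move: (wb _ ne) => /mnm_lepP /(_ j) h h'; apply: leq_trans h.
Qed.

Lemma delta_supp p (e : gen p) : supp_le (gdeg e) (delta e).
Proof.
move=> e'; rewrite /delta; case: (e' =P e) => [->|_]; last by rewrite eqxx.
by rewrite lepm_refl.
Qed.

(** The class of 1 has a lift [f] of degree 0. If [e] had another degree, subtracting the multiple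
    [augc e] of [f] from [e] would give an element of the kernel of the augmentation, hence a
    boundary, with coefficient 1 at [e]; [bd_top] forbids this. *)
Lemma gdeg0 (e : gen 0) : gdeg e = 0%MM.
Proof.
apply/eqP/negPn/negP => ne.
have [f fs f1] := aug_surj G.
pose v e' := delta e e' - augc e * f e'.
have vs : supp_le (gdeg e) v.
  move=> e'; rewrite /v /delta; case: (e' =P e) => [->|_]; first by rewrite lepm_refl.
  rewrite sub0r oppr_eq0 mulf_eq0 negb_or => /andP [_ /fs ->].
  by apply/mnm_lepP => i; rewrite mnm0E.
have [|w ws wE] := aug_exact vs.
  move=> _; rewrite /v; under eq_bigr do rewrite mulrBl.
  rewrite sumrB; apply/eqP; rewrite subr_eq0; apply/eqP.
  under [RHS]eq_bigr do rewrite -mulrA.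
  rewrite -mulr_sumr f1 mulr1 (bigD1 e) //= /delta eqxx mul1r big1 ?addr0 //.
  by move=> i /negbTE ->; rewrite mul0r.
have := wE e; rewrite -/(bd w e) (bd_top ws) /v /delta eqxx.
have [->|/fs h] := eqVneq (f e) 0; last by rewrite h eqxx in ne.
by move/eqP; rewrite mulr0 subr0 oner_eq0.
Qed.

Lemma short_set1U j T b p (e : gen p) :
  short (j |: T) b e = (gdeg e j < b j)%N || short T b e.
Proof.
apply/existsP/orP => [[i]|].
  rewrite in_setU1 => /andP [/orP [/eqP ->|iT] h]; first by left.
  by right; apply/existsP; exists i; rewrite iT.
case=> [h|/existsP [i /andP [iT h]]].
  by exists j; rewrite setU11.
by exists i; rewrite in_setU1 iT orbT.
Qed.

Lemma rel_exact0 (T : {set 'I_s}) (b : 'X_{1..s}) j : j \in T -> (0 < b j)%N -> rel_exact T b 0.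
Proof.
move=> jT bj v vb _; exists (fun=> 0) => [e|e _]; first by rewrite eqxx.
by apply/existsP; exists j; rewrite jT gdeg0 mnm0E.
Qed.

Lemma lepm_subU (c b : 'X_{1..s}) j : (0 < b j)%N ->
  (c <= b - U_(j))%MM = (c <= b)%MM && (c j < b j)%N.
Proof.
move=> bj; apply/mnm_lepP/andP => [h|[/mnm_lepP h cj] i].
  split; first by apply/mnm_lepP => i; apply: leq_trans (h i) _;
    rewrite mnmBE leq_subr.
  by have := h j; rewrite mnmBE mnm1E eqxx subn1 -ltnS prednK.
rewrite mnmBE mnm1E; case: eqP => [<-|_]; last by rewrite subn0.
by rewrite subn1 -ltnS prednK.
Qed.

Lemma short_le (T : {set 'I_s}) (b c : 'X_{1..s}) p q (e : gen p) (e' : gen q) :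
  (gdeg e' <= gdeg e)%MM -> (forall i, i \in T -> c i = b i) ->
  short T c e -> short T b e'.
Proof.
move=> /mnm_lepP h cb /existsP [i /andP [iT hi]]; apply/existsP; exists i.
by rewrite iT -cb //; apply: leq_ltn_trans (h i) hi.
Qed.

(* Long exact sequence of Tor for the quotient by one more variable t_j. *)
Lemma rel_exact_chase (T : {set 'I_s}) (b : 'X_{1..s}) j p : j \notin T -> (0 < b j)%N ->
  rel_exact T b p.+1 -> rel_exact T (b - U_(j))%MM p ->
  rel_exact (j |: T) b p.+1.
Proof.
move=> jT bj h1 h0 v vb vT.
have bT i : i \in T -> (b - U_(j))%MM i = b i.
  move=> iT; rewrite mnmBE mnm1E; case: eqP => [ji|]; last by rewrite subn0.
  by rewrite ji iT in jT.
(* [x] is [bd v] without its terms in (T). Since [bd v] vanishes modulo T and t_j, what remains is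
   divisible by t_j, so it is an element of degree b - e_j. *)
have [x xE] : exists x : gen p -> k,
    forall e', x e' = if short T b e' then 0 else bd v e'.
  by exists (fun e' => if short T b e' then 0 else bd v e').
have xs : supp_le (b - U_(j))%MM x.
  move=> e'; rewrite xE; case: ifP => [|sF hx]; first by rewrite eqxx.
  rewrite lepm_subU // (supp_le_bd vb) //=.
  by have := vT e' hx; rewrite short_set1U sF orbF.
have xT e' : bnd x e' != 0 -> short T (b - U_(j))%MM e'.
  case: p v vb vT x xE xs {h1 h0} e' => [|p] v vb vT x xE xs e' /=.
    by rewrite eqxx.
  (* As [bd v] is a cycle, [bd x] is up to sign the boundary of the dropped terms, which stays in
     (T). *)
  have -> : bd x e' = - bd (fun e => bd v e - x e) e'.
    by rewrite bdB bd_bd sub0r opprK.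
  rewrite oppr_eq0 => /bd_supp [e]; rewrite xE; case: ifP => [hs _|_].
    move=> /andP [le _]; apply: short_le hs => // i iT.
    by rewrite bT.
  by rewrite subrr eqxx.
have [u us uT] := h0 _ xs xT.
have usb : supp_le b u.
  by move=> e /us; rewrite lepm_subU // => /andP [].
(* The scalar vector of t_j u in degree b is [u] itself. Modulo T, [v] and t_j u have the same
   boundary, so [v'] is a cycle modulo T, and it agrees with [v] modulo t_j. *)
pose v' e := v e - u e.
have v's : supp_le b v'.
  move=> e; rewrite /v'; have [->|/vb //] := eqVneq (v e) 0.
  by rewrite sub0r oppr_eq0 => /usb.
have [|w ws wT] := h1 _ v's.
  move=> e' /=; rewrite bdB => ne.
  case sT: (short T b e') => //.
  have xe : bd v e' = x e' by rewrite xE sT.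
  rewrite xe in ne; have := uT _ ne.
  by rewrite -sT; apply: short_le; [exact: lepm_refl|exact: bT].
exists w => // e; rewrite short_set1U.
have [/= ue|ue _] := eqVneq (u e) 0.
  move=> ne; apply/orP; right; apply: wT.
  by rewrite /v' ue subr0.
by move/us: ue; rewrite lepm_subU // => /andP [_ ->].
Qed.

(** Modulo the variables in the support of b, only the generators of degree exactly b survive in
    degree b. Such a generator is a cycle there, and by [bd_top] it is not a boundary. *)
Lemma no_gen (b : 'X_{1..s}) p : rel_exact [set j | 0 < b j]%N b p ->
  forall e : gen p, gdeg e <> b.
Proof.
move=> ex e eb.
have shortb q (e' : gen q) : (gdeg e' <= b)%MM -> gdeg e' != b ->
    short [set j | 0 < b j]%N b e'.
  move=> /mnm_lepP le ne; apply/existsP.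
  have [j hj|nj] := pickP (fun j => gdeg e' j < b j)%N.
    by exists j; rewrite inE hj (leq_ltn_trans _ hj).
  case/eqP: ne; apply/mnmP => j; apply/eqP; rewrite eqn_leq le /=.
  by rewrite leqNgt nj.
have [||w ws] := ex (delta e).
- by rewrite -eb; apply: delta_supp.
- case: p e eb {ex} => [|p] e eb e' /=; first by rewrite eqxx.
  by rewrite bd_delta => /coef_lt; rewrite eb => /andP []; apply: shortb.
move/(_ e); rewrite bd_top ?eb // /delta eqxx subr0 oner_eq0 => /(_ isT).
by move/existsP => [j]; rewrite eb ltnn andbF.
Qed.

(** The chase reduces to T = {j}. There b and b - e_j have the same support, so multiplication by
    t_j between these two degrees of the quotient is injective. *)
Lemma rel_exact_ge2 (b : 'X_{1..s}) p j (T : {set 'I_s}) : (1 < b j)%N -> j \in T ->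
  (forall i, i \in T -> 0 < b i)%N -> rel_exact T b p.
Proof.
move: {2}#|T| (leqnn #|T|) => n; elim: n T b p => [|n IH] T b p Tn bj jT Tb.
  by move: Tn; rewrite leqn0 cards_eq0 => /eqP TE; rewrite TE inE in jT.
case: p => [|p]; first by apply: rel_exact0 jT (ltnW bj).
have [/existsP [i /andP [iT ij]]|/existsPn nT] :=
    boolP [exists i in T, i != j].
  rewrite -(setD1K iT).
  have jT' : j \in T :\ i by rewrite !inE eq_sym ij.
  have Tn' : (#|T :\ i| <= n)%N by rewrite (cardsD1 i) iT in Tn.
  apply: rel_exact_chase.
  - by rewrite !inE eqxx.
  - exact: Tb.
  - by apply: IH => // l; rewrite !inE => /andP [_ /Tb].
  apply: IH => //.
    by rewrite mnmBE mnm1E (negbTE ij) subn0.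
  move=> l; rewrite !inE => /andP [li /Tb].
  by rewrite mnmBE mnm1E eq_sym (negbTE li) subn0.
have -> : T = [set j].
  apply/setP => i; rewrite inE; have := nT i; rewrite negb_and negbK.
  by case: eqP => [->|_]; rewrite ?jT // orbF => /negbTE.
move=> v vb vT.
have bj0 := ltnW bj.
have bvs : supp_le (b - U_(j))%MM (bd v).
  move=> e' ne; rewrite lepm_subU // (supp_le_bd vb) //=.
  by have /existsP [i] := vT _ ne; rewrite inE => /andP [/eqP ->].
(* After division by t_j, [bd v] is still a boundary. In F_0 this uses that b is a face whenever b -
   e_j is. *)
have [u us uE] : exists2 u : gen p.+1 -> k, supp_le (b - U_(j))%MM u &
    forall e, bd v e = bd u e.
  case: p v vb {vT} bvs => [|p] v vb bvs.
    apply: aug_exact => // fb; apply: aug_bd vb _.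
    apply: faceS fb => i; rewrite mnmBE mnm1E.
    by case: eqP => [<-|_]; [rewrite subn_gt0|rewrite subn0].
  by apply: coef_exact => // e'; apply: bd_bd.
have vu : supp_le b (fun e => v e - u e).
  move=> e; have [->|/vb //] := eqVneq (v e) 0.
  by rewrite sub0r oppr_eq0 => /us; rewrite lepm_subU // => /andP [].
have [|w ws wE] := coef_exact vu.
  by move=> e'; rewrite -/(bd _ e') bdB uE subrr.
exists w => // e; rewrite /bd -wE opprB addrC subrK => /us.
rewrite lepm_subU // => /andP [_ h]; apply/existsP; exists j.
by rewrite set11.
Qed.

Lemma no_gen_ge2 p (e : gen p) j : (gdeg e j <= 1)%N.
Proof.
rewrite leqNgt; apply/negP => h.
have := @no_gen (gdeg e) p; case/(_ _ e) => //.
apply: (@rel_exact_ge2 _ _ j) => //; first by rewrite inE ltnW.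
by move=> i; rewrite inE.
Qed.

(** Otherwise [e] would be a cycle, hence a boundary, against [bd_top]. *)
Lemma gen_coef_neq0 p (e : gen p.+1) : exists e', coef e e' != 0.
Proof.
have [e1 h|nh] := pickP (fun e' => coef e e' != 0); first by exists e1.
have [|w ws wE] := coef_exact (@delta_supp _ e).
  by move=> e'; rewrite -/(bd _ e') bd_delta; apply/eqP/negbFE/nh.
have := wE e; rewrite -/(bd w e) (bd_top ws) /delta eqxx => /eqP.
by rewrite oner_eq0.
Qed.

(** On a face degree the relation [coef_augc] is one between scalars, and F_0 is generated in degree
    0. So [coef e] already lies in the kernel of the augmentation in degree 0 and is a boundary from
    there, hence zero by [bd_top]. *)
Lemma gen1_nonface (e : gen 1) : ~~ face (gdeg e).
Proof.
apply/negP => fe; have [e' ne] := gen_coef_neq0 e.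
have cs : supp_le 0%MM (coef e).
  by move=> e1 _; rewrite gdeg0 lepm_refl.
have [|w ws wE] := aug_exact cs; first by move=> _; apply: coef_augc.
move: ne; rewrite wE -/(bd w e') bd_top ?eqxx //.
by rewrite gdeg0.
Qed.

Lemma mdeg_lt (b c : 'X_{1..s}) :
  (b <= c)%MM -> b != c -> (mdeg b < mdeg c)%N.
Proof.
move=> le ne; rewrite -(submK le) mdegD -{1}[mdeg b]add0n ltn_add2r.
rewrite lt0n mdeg_eq0; apply: contra ne => /eqP h.
by rewrite -(submK le) h add0m.
Qed.

(** F_1 starts in total degree 2, and every differential strictly raises the degree. *)
Lemma gen_mdeg : (forall b : 'X_{1..s}, (mdeg b <= 1)%N -> face b) ->
  forall p (e : gen p.+1), (p.+2 <= mdeg (gdeg e))%N.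
Proof.
move=> face1; elim=> [|p IH] e.
  rewrite ltnNge; apply/negP => /face1; apply/negP; exact: gen1_nonface.
have [e' /coef_lt /andP [h1 h2]] := gen_coef_neq0 e.
by apply: leq_trans (mdeg_lt h1 h2); rewrite ltnS IH.
Qed.

End FrameTheory.

(** * Euler characteristic of a frame *)

Section EulerCharacteristic.
Variables (k : fieldType) (s : nat) (face : pred 'X_{1..s}).
Hypothesis faceS : forall b c : 'X_{1..s},
  (forall j, (0 < b j)%N -> (0 < c j)%N) -> face c -> face b.
Variables (G : frame k face) (b : 'X_{1..s}).
Local Notation gen := (gen G).

Local Notation below p := {e : gen p | (gdeg e <= b)%MM}.
Local Notation nbelow p := #|{: below p}|.

Let gof p (i : 'I_(nbelow p)) : gen p := val (enum_val i).

Let extend p (u : 'rV[k]_(nbelow p)) (e : gen p) : k :=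
  if insub e is Some x then u 0 (enum_rank (x : below p)) else 0.

Lemma extend_supp p u : supp_le b (@extend p u).
Proof. by move=> e; rewrite /extend; case: insubP => [x|]; rewrite ?eqxx. Qed.

Lemma extend_gof p u i : @extend p u (gof i) = u 0 i.
Proof. by rewrite /extend /gof valK enum_valK. Qed.

Lemma sum_below p (w f : gen p -> k) : supp_le b w ->
  \sum_e w e * f e = \sum_i w (gof i) * f (gof i).
Proof.
move=> wb; rewrite (bigID (fun e => gdeg e <= b)%MM) /= [X in _ + X]big1.
  rewrite addr0 (big_sub (fun e => gdeg e <= b)%MM) //=.
  by rewrite -(big_enum_val (fun x => w (val x) * f (val x))).
move=> e eb; have [->|/wb] := eqVneq (w e) 0; first by rewrite mul0r.
by rewrite (negbTE eb).
Qed.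

(** The differentials in degree b, acting on row vectors from the right. [aug] is the augmentation
    onto the component of degree b of the quotient, which is [k] or 0 according to [face b]. *)
Let D p : 'M[k]_(nbelow p.+1, nbelow p) := \matrix_(i, j) coef (gof i) (gof j).
Let aug : 'cV[k]_(nbelow 0) := \col_i (if face b then augc (gof i) else 0).

Lemma gof_le p (i : 'I_(nbelow p)) : (gdeg (gof i) <= b)%MM.
Proof. exact: (valP (enum_val i)). Qed.

Lemma coef_supp p (i : 'I_(nbelow p.+1)) : supp_le b (coef (gof i)).
Proof.
move=> e /coef_lt /andP [h _]; exact: lepm_trans h (gof_le i).
Qed.

Lemma sub_D p (u : 'rV_(nbelow p)) (w : gen p.+1 -> k) : supp_le b w ->
  (forall e, extend u e = \sum_e1 w e1 * coef e1 e) -> (u <= D p)%MS.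
Proof.
move=> ws wE; apply/submxP; exists (\row_i w (gof i)).
apply/rowP => j; rewrite mxE -extend_gof wE sum_below //.
by apply: eq_bigr => i _; rewrite !mxE.
Qed.

Lemma kermx_D p : (kermx (D p) :=: D p.+1)%MS.
Proof.
apply/eqmxP/andP; split.
  apply/row_subP => i.
  have : row i (kermx (D p)) *m D p = 0 by apply/sub_kermxP/row_sub.
  move: (row i _) => u uD.
  have [|w ws wE] := coef_exact (extend_supp (u := u)); last exact: sub_D wE.
  move=> e'; rewrite sum_below; last exact: extend_supp.
  have [e'b|ne'b] := boolP (gdeg e' <= b)%MM.
    have /matrixP/(_ 0 (enum_rank (Sub e' e'b : below p))) := uD.
    rewrite !mxE => h; rewrite -[RHS]h; apply: eq_bigr => j _.
    by rewrite extend_gof mxE [in RHS]/gof enum_rankK.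
  apply: big1 => j _; have [->|/coef_supp] := eqVneq (coef (gof j) e') 0.
    by rewrite mulr0.
  by rewrite (negbTE ne'b).
apply/sub_kermxP/matrixP => i j; rewrite !mxE.
rewrite -[RHS](coef_coef (gof i) (gof j)) sum_below; last exact: coef_supp.
by apply: eq_bigr => l _; rewrite !mxE.
Qed.

Lemma kermx_aug : (kermx aug :=: D 0)%MS.
Proof.
apply/eqmxP/andP; split.
  apply/row_subP => i.
  have : row i (kermx aug) *m aug = 0 by apply/sub_kermxP/row_sub.
  move: (row i _) => u uD.
  have [fb|w ws wE] := aug_exact (extend_supp (u := u)); last exact: sub_D wE.
  rewrite sum_below; last exact: extend_supp.
  have /matrixP/(_ 0 0) := uD.
  rewrite !mxE => h; rewrite -[RHS]h; apply: eq_bigr => j _.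
  by rewrite extend_gof mxE fb.
apply/sub_kermxP/matrixP => i j; rewrite !mxE.
have [fb|nfb] := boolP (face b); last first.
  by rewrite big1 // => l _; rewrite !mxE (negbTE nfb) mulr0.
rewrite -[RHS](coef_augc (e := gof i)).
  rewrite sum_below; last exact: coef_supp.
  by apply: eq_bigr => l _; rewrite !mxE fb.
apply: faceS fb => l hl; apply: leq_trans hl _.
by have /mnm_lepP := gof_le i.
Qed.

Lemma rank_aug : \rank aug = face b.
Proof.
have [fb|nfb] := boolP (face b); last first.
  suff -> : aug = 0 by rewrite mxrank0.
  by apply/colP => i; rewrite !mxE (negbTE nfb).
apply/eqP; rewrite eqn_leq rank_leq_col lt0n mxrank_eq0.
apply/eqP => /matrixP aug0; have [f fs] := aug_surj G.
rewrite sum_below; last first.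
  by move=> e /fs ->; apply/mnm_lepP => i; rewrite mnm0E.
rewrite big1 => [/esym/eqP|i _]; first by rewrite oner_eq0.
have := aug0 i 0.
by rewrite !mxE fb => ->; rewrite mulr0.
Qed.

(** Rank-nullity along the exact strand of degree b; the ranks telescope in the alternating sum. *)
Lemma euler_below N : (forall e : gen N, ~~ (gdeg e <= b)%MM) ->
  \sum_(p < N) (-1) ^+ p * (#|[set e : gen p | (gdeg e <= b)%MM]|)%:R
    = (face b)%:R :> int.
Proof.
have nE p : #|[set e : gen p | (gdeg e <= b)%MM]| = nbelow p.
  by rewrite card_sig cardsE.
pose n p := #|[set e : gen p | (gdeg e <= b)%MM]|; pose rk p := \rank (D p).
have rk0 : (n 0 = face b + rk 0)%N.
  by rewrite /n /rk nE -kermx_aug mxrank_ker rank_aug subnKC // -rank_aug rank_leq_row.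
have rkS p : (n p.+1 = rk p + rk p.+1)%N.
  by rewrite /n /rk nE -kermx_D mxrank_ker subnKC // rank_leq_row.
have sumE m : \sum_(p < m.+1) (-1) ^+ p * (n p)%:R
    = (face b)%:R + (-1) ^+ m * (rk m)%:R :> int.
  elim: m => [|m IH].
    by rewrite big_ord_recr big_ord0 /= add0r rk0 natrD !mul1r.
  rewrite big_ord_recr /= IH rkS natrD exprS mulN1r !mulNr mulrDr.
  by rewrite -addrA opprD addNKr.
move=> Nb; have : n N = 0%N by apply: eq_card0 => e; rewrite inE (negbTE (Nb e)).
case: N {Nb} => [|m].
  by rewrite big_ord0 rk0; case: (face b).
rewrite sumE rkS => /eqP; rewrite addn_eq0 => /andP [/eqP -> _].
by rewrite mulr0 addr0.
Qed.

End EulerCharacteristic.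

(** * Gap numbers *)

Section SubsetSums.
Variables (T : finType) (V : zmodType).

Lemma sum_subset_setU1 (v : T) (A : {set T}) (F : {set T} -> V) : v \notin A ->
  \sum_(B : {set T} | B \subset v |: A) F B
    = \sum_(B : {set T} | B \subset A) (F B + F (v |: B)).
Proof.
move=> vA; rewrite big_split /= (bigID (fun B : {set T} => v \in B)) /= addrC.
congr (_ + _).
  apply: eq_bigl => B; rewrite -subDset.
  have [vB|vB] := boolP (v \in B); rewrite ?andbF ?andbT.
    by apply/esym/negP => /subsetP /(_ v vB); apply/negP.
  by rewrite (setDidPl _) // disjoint_sym disjoints1.
rewrite (reindex_onto (fun B => v |: B) (fun B => B :\ v)) /=; last first.
  by move=> B /andP [_ vB]; rewrite setD1K.
apply: eq_bigl => B; rewrite setU11 andbT.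
have [vB|vB] := boolP (v \in B).
  have -> : (B \subset A) = false.
    by apply/negP => /subsetP /(_ v vB); apply/negP.
  apply/negP => /andP [_ /eqP E]; move: vB.
  by rewrite -E !inE eqxx.
rewrite setU1K // eqxx andbT; apply/subsetP/subsetP => h u uB.
  have := h u; rewrite !inE uB orbT => /(_ isT) /orP [/eqP E|//].
  by rewrite -E uB in vB.
by have := uB; rewrite !inE => /orP [->//|/h ->]; rewrite orbT.
Qed.

End SubsetSums.

Lemma sum_subset_sign (T : finType) (A : {set T}) :
  \sum_(B : {set T} | B \subset A) (-1) ^+ #|B| = (A == set0)%:R :> int.
Proof.
have [->|[v vA]] := set_0Vmem A.
  rewrite eqxx (big_pred1 set0) ?cards0 // => B; exact: subset0.
have -> : (A == set0) = false.
  by apply/negP => /eqP E; rewrite E inE in vA.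
rewrite -(setD1K vA) sum_subset_setU1 ?setD11 // big1 // => B BA.
rewrite cardsU1; have -> : v \notin B.
  by apply/negP => /(subsetP BA); rewrite setD11.
by rewrite exprS mulN1r subrr.
Qed.

Lemma set_mnmE s (A : {set 'I_s}) j : set_mnm A j = (j \in A).
Proof.
rewrite /set_mnm mnm_sumE; under eq_bigr do rewrite mnm1E.
have [jA|jA] := boolP (j \in A).
  rewrite (bigD1 j) //= eqxx big1 // => i /andP [_ /negbTE ->]//.
by rewrite big1 // => i iA; case: eqP => // ij; rewrite -ij iA in jA.
Qed.

Lemma set_max s (A : {set 'I_s}) : A != set0 ->
  exists2 v, v \in A & forall u, u \in A :\ v -> (u < v)%N.
Proof.
case/set0Pn => a aA; case: (arg_maxnP (fun i : 'I_s => val i) aA) => v vA vmax.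
exists v => // u; rewrite !inE ltn_neqAle => /andP [uv uA].
by rewrite (inj_eq val_inj) uv; apply: vmax.
Qed.

Section Gap.
Variable s : nat.
Implicit Types (A B : {set 'I_s}) (u v w : 'I_s).

Let vals A := [seq val j | j <- enum A].

Lemma vals_sorted A : sorted ltn (vals A).
Proof.
apply: (@subseq_sorted _ _ ltn_trans _ (map val (enum 'I_s))).
  rewrite /vals enumT {1}/enum_mem -enumT; apply: map_subseq; exact: filter_subseq.
by rewrite val_enum_ord iota_ltn_sorted.
Qed.

Lemma vals_setU1 v A : (forall u, u \in A -> (u < v)%N) ->
  vals (v |: A) = rcons (vals A) v.
Proof.
move=> Av; apply: (@irr_sorted_eq _ ltn); first exact: ltn_trans.
- exact: ltnn.
- exact: vals_sorted.
- rewrite -cats1 (sorted_pairwise ltn_trans) pairwise_cat /=.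
  rewrite -(sorted_pairwise ltn_trans) vals_sorted !andbT.
  apply/allrelP => x y /mapP [u]; rewrite mem_enum => /Av uv -> .
  by rewrite inE => /eqP ->.
move=> x; rewrite mem_rcons inE; apply/mapP/orP.
  case=> u; rewrite mem_enum in_setU1 => /orP [/eqP ->|uA] ->; first by left.
  by right; apply: map_f; rewrite mem_enum.
case=> [/eqP ->|/mapP [u uA ->]].
  by exists v; rewrite // mem_enum setU11.
by exists u; rewrite // mem_enum in_setU1 -mem_enum uA orbT.
Qed.

Lemma gapE A : gap A =
  (\sum_(0 <= l < #|A|.-1) (1 < nth 0 (vals A) l.+1 - nth 0 (vals A) l))%N.
Proof.
rewrite /gap -sum1_card big_mkord big_mkcond /=.
by apply: eq_bigr => l _; rewrite inE; case: ifP.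
Qed.

Lemma size_vals A : size (vals A) = #|A|.
Proof. by rewrite size_map cardE. Qed.

(** A new maximum is appended to the sorted list, so only the pair w, v can contribute a new gap. *)
Lemma gap_setU1 v w A : w \in A -> (forall u, u \in A -> (u <= w)%N) ->
  (w < v)%N -> gap (v |: A) = (gap A + (w.+1 < v))%N.
Proof.
move=> wA Aw wv.
have Av u : u \in A -> (u < v)%N by move=> /Aw h; apply: leq_ltn_trans wv.
have valsA : vals A = rcons (vals (A :\ w)) w.
  rewrite -{1}(setD1K wA) vals_setU1 // => u.
  rewrite !inE => /andP [uw /Aw]; rewrite leq_eqVlt.
  by rewrite (inj_eq val_inj) (negbTE uw).
have cA : #|A| = #|A :\ w|.+1 by rewrite (cardsD1 w) wA.
have vA : v \notin A by apply/negP => /Av; rewrite ltnn.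
rewrite !gapE cardsU1 vA add1n vals_setU1 //= cA /= big_nat_recr //=.
congr (_ + _)%N.
  apply: eq_big_nat => l /andP [_ lA].
  by rewrite !nth_rcons size_vals cA !ltnS lA (ltnW lA).
rewrite !nth_rcons size_vals cA ltnn eqxx ltnSn valsA nth_rcons size_vals.
by rewrite ltnn eqxx ltn_subRL addn1.
Qed.

Lemma gap_small A : (#|A| <= 1)%N -> gap A = 0%N.
Proof. by rewrite gapE; case: #|A| => [|[|]] // _; rewrite big_nil. Qed.

End Gap.

(* The coefficient of t^A in the K-polynomial. *)
Definition kappa s (A : {set 'I_s}) : int :=
  (A == set0)%:R + (-1) ^+ #|A|.+1 * (gap A)%:R.

(** The gaps inside B occur with opposite signs and cancel, leaving the gap between max B and v. For
    B empty the right-hand side is the value 1 of [kappa set0]. *)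
Lemma kappa_setU1 s (v : 'I_s) (B : {set 'I_s}) : (forall u, u \in B -> (u < v)%N) ->
  kappa B + kappa (v |: B) = (-1) ^+ #|B| * [forall u in B, u.+1 < v]%N%:R.
Proof.
move=> Bv; have vB : v \notin B by apply/negP => /Bv; rewrite ltnn.
have vB0 : (v |: B == set0) = false.
  by apply/negP => /eqP /setP /(_ v); rewrite setU11 inE.
rewrite /kappa vB0 add0r cardsU1 vB.
have [->|B0] := eqVneq B set0.
  rewrite cards0 !gap_small ?cards0 ?setU0 ?cards1 // !mulr0 !addr0 mul1r.
  by have -> : [forall u in (set0 : {set 'I_s}), u.+1 < v]%N by apply/forall_inP => u; rewrite inE.
have [w wB wmax] := set_max B0.
have Bw u : u \in B -> (u <= w)%N.
  move=> uB; have [->//|uw] := eqVneq u w.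
  by apply/ltnW/wmax; rewrite !inE uw.
rewrite (gap_setU1 wB Bw (Bv _ wB)) add0r !exprS !mulN1r opprK natrD mulrDr.
rewrite mulNr addKr; congr (_ * (nat_of_bool _)%:R).
apply/idP/forall_inP => [h u /Bw uw|]; last exact.
by apply: leq_ltn_trans h.
Qed.

(** Membership of t^b in the complement of J, which depends only on the support of b. *)
Definition path_face s (b : 'X_{1..s}) : bool :=
  ~~ [exists i : 'I_s, exists j : 'I_s, [&& i.+1 < j, 0 < b i & 0 < b j]]%N.

Lemma path_faceP s (b : 'X_{1..s}) :
  reflect (forall i j : 'I_s, (i.+1 < j)%N -> (0 < b i)%N -> (0 < b j)%N -> False)
    (path_face b).
Proof.
apply: (iffP idP) => [/existsPn h i j ij bi bj|h].
  by have /existsPn /(_ j) := h i; rewrite ij bi bj.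
apply/existsPn => i; apply/existsPn => j; apply/and3P => -[]; exact: h.
Qed.

Lemma path_faceS s (b c : 'X_{1..s}) :
  (forall j, (0 < b j)%N -> (0 < c j)%N) -> path_face c -> path_face b.
Proof.
by move=> bc /path_faceP h; apply/path_faceP => i j ij /bc ci /bc cj; apply: h ij _ _.
Qed.

Lemma path_face_mdeg1 s (b : 'X_{1..s}) : (mdeg b <= 1)%N -> path_face b.
Proof.
move=> b1; apply/path_faceP => i j ij bi bj; move: b1; rewrite mdegE.
rewrite (bigD1 i) //= (bigD1 j) /=; last first.
  by apply/eqP => E; rewrite E ltnNge leqnSn in ij.
by rewrite addnA leqNgt (leq_trans _ (leq_addr _ _)) // (leq_add bi bj).
Qed.

Lemma path_face_set s (A : {set 'I_s}) : path_face (set_mnm A) =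
  ~~ [exists i in A, exists j in A, i.+1 < j]%N.
Proof.
apply/path_faceP/idP => [h|h i j ij].
  apply/negP => /exists_inP [i iA /exists_inP [j jA ij]].
  by apply: (h i j ij); rewrite set_mnmE lt0b.
rewrite !set_mnmE !lt0b => iA jA; case/negP: h.
by apply/exists_inP; exists i => //; apply/exists_inP; exists j.
Qed.

(** With v = max A, pair B with v |: B. By [kappa_setU1] what remains is the sum of (-1)^|B| over
    subsets of T, the elements of A at distance more than 1 from v. It is 1 or 0 as T is empty or
    not, and if any two elements of A are that far apart, then the smaller one is in T. *)
Lemma sum_kappa s (A : {set 'I_s}) :
  \sum_(B : {set 'I_s} | B \subset A) kappa B = (path_face (set_mnm A))%:R.
Proof.
rewrite path_face_set; have [->|A0] := eqVneq A set0.
  rewrite (big_pred1 set0) => [|B]; last exact: subset0.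
  rewrite /kappa eqxx gap_small ?cards0 // mulr0 addr0.
  by have -> : [exists i in (set0 : {set 'I_s}), exists j in (set0 : {set 'I_s}), i.+1 < j]%N = false
    by apply/existsP => -[i]; rewrite inE.
have [v vA vmax] := set_max A0.
pose T := [set u in A :\ v | u.+1 < v]%N.
rewrite -{1}(setD1K vA) sum_subset_setU1 ?setD11 //.
transitivity (\sum_(B : {set 'I_s} | B \subset T) (-1) ^+ #|B| : int).
  rewrite (bigID (fun B : {set 'I_s} => B \subset T)) /= addrC big1 ?add0r.
    apply: eq_big => [B|B /andP [BA BT]].
      case BT: (B \subset T); rewrite ?andbF // andbT.
      by apply: subset_trans BT _; apply/subsetP => u; rewrite inE => /andP [].
    rewrite kappa_setU1; last by move=> u /(subsetP BA) /vmax.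
    have -> : [forall u in B, u.+1 < v]%N; last by rewrite mulr1.
    by apply/forall_inP => u /(subsetP BT); rewrite inE => /andP [].
  move=> B /andP [BA nBT].
  rewrite kappa_setU1; last by move=> u /(subsetP BA) /vmax.
  have -> : [forall u in B, u.+1 < v]%N = false; last by rewrite mulr0.
  apply/negP => /forall_inP h; case/negP: nBT; apply/subsetP => u uB.
  by rewrite inE (subsetP BA) // h.
rewrite sum_subset_sign; congr (nat_of_bool _)%:R; apply/eqP/idP => [T0|h].
  apply/negP => /exists_inP [i iA /exists_inP [j jA ij]].
  have jv : (j <= v)%N.
    by have [->//|jv] := eqVneq j v; apply/ltnW/vmax; rewrite !inE jv.
  move/setP/(_ i): T0; rewrite !inE iA andbT (leq_trans ij jv) andbT.
  by case: eqP => // E; rewrite -E leqNgt (ltnW ij) in jv.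
apply/setP => u; rewrite !inE; apply/negP => /andP [/andP [_ uA] uv].
case/negP: h; apply/exists_inP; exists u => //.
by apply/exists_inP; exists v.
Qed.

(** * Linearity of the resolution of the path ideal *)

Lemma set_mnm_subU s (A : {set 'I_s}) j :
  (set_mnm A - U_(j))%MM = set_mnm (A :\ j).
Proof.
apply/mnmP => i; rewrite mnmBE mnm1E !set_mnmE !inE eq_sym.
by case: eqP; case: (i \in A).
Qed.

Lemma set_mnm_le s (A B : {set 'I_s}) :
  (set_mnm A <= set_mnm B)%MM = (A \subset B).
Proof.
apply/mnm_lepP/subsetP => h i.
  by have := h i; rewrite !set_mnmE; case: (i \in A); case: (i \in B).
by rewrite !set_mnmE; have := h i; case: (i \in A) => // ->.
Qed.

Lemma mdeg_set_mnm s (A : {set 'I_s}) : mdeg (set_mnm A) = #|A|.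
Proof.
rewrite mdegE; under eq_bigr do rewrite set_mnmE.
by rewrite -sum1_card [RHS]big_mkcond; apply: eq_bigr => i _; case: (i \in A).
Qed.

Lemma set_mnm_inj s : injective (@set_mnm s).
Proof.
move=> A B /mnmP AB; apply/setP => i.
by have := AB i; rewrite !set_mnmE; case: (i \in A); case: (i \in B).
Qed.

Section PathFrame.
Variables (k : fieldType) (s : nat) (G : frame k (@path_face s)).
Local Notation gen := (gen G).
Local Notation rel_exact := (rel_exact G).
Implicit Types (A S T : {set 'I_s}).

(** With no variable divided out this is exactness of the resolution; at p = 0 the component of
    degree b of Q/J must be zero. *)
Lemma rel_exact_set0 b p : (p = 0%N -> ~~ path_face b) -> rel_exact set0 b p.
Proof.
have shortF q (e : gen q) : short set0 b e = false.
  by apply/existsP => -[i]; rewrite inE.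
move=> bF v vb vT.
suff [w ws wE] : exists2 w : gen p.+1 -> k, supp_le b w &
    forall e, v e = bd w e.
  by exists w => // e; rewrite wE subrr eqxx.
case: p bF v vb vT => [|p] bF v vb vT.
  by apply: aug_exact => // fb; have := bF erefl; rewrite fb.
apply: coef_exact => // e'; apply/eqP/negPn/negP => /vT.
by rewrite shortF.
Qed.

(** Removing j from S leads to the pairs (A, S - j) and (A - j, S - j). The difference grows in the
    first and is unchanged in the second, so it remains a nonface down to S empty. *)
Lemma rel_exact_nonface A S p : S \subset A ->
  ~~ path_face (set_mnm (A :\: S)) -> rel_exact S (set_mnm A) p.
Proof.
move: {2}#|S| (leqnn #|S|) => n; elim: n S A p => [|n IH] S A p Sn SA nf.
  move: Sn; rewrite leqn0 cards_eq0 => /eqP SE; rewrite SE setD0 in nf *.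
  by apply: rel_exact_set0.
have [S0|[j jS]] := set_0Vmem S; first by apply: IH => //; rewrite S0 cards0.
have jA := subsetP SA _ jS.
have bj : (0 < set_mnm A j)%N by rewrite set_mnmE jA.
case: p => [|p]; first exact: rel_exact0 jS bj.
rewrite -(setD1K jS).
have Sn' : (#|S :\ j| <= n)%N by rewrite (cardsD1 j) jS in Sn.
have DE : (A :\ j) :\: (S :\ j) = A :\: S.
  apply/setP => i; rewrite !inE.
  by have [->|] := eqVneq i j; rewrite ?jS ?andbF.
apply: rel_exact_chase.
- by rewrite setD11.
- exact: bj.
- apply: IH => //; first exact: subset_trans (subD1set _ _) SA.
  apply: contra nf; apply: path_faceS => i; rewrite !set_mnmE !lt0b !inE.
  by move=> /andP [/negbTE -> ->]; rewrite andbF.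
by rewrite set_mnm_subU; apply: IH => //; [exact: setSD|rewrite DE].
Qed.

(** Remove u = min T. One term of the chase has difference set {u, v}, a nonface because some w in T
    lies strictly between; the other is the induction hypothesis for T - u. *)
Lemma rel_exact_setU1 T (v : 'I_s) p : (forall u, u \in T -> (u < v)%N) ->
  (p < #|T|)%N -> rel_exact T (set_mnm (v |: T)) p.
Proof.
move: {2}#|T| (leqnn #|T|) => n; elim: n T p => [|n IH] T p Tn Tv pT.
  by have := leq_trans pT Tn.
have T0 : T != set0 by rewrite -card_gt0 (leq_trans _ pT).
have [a aT] := set0Pn _ T0.
have [u uT' umin] := arg_minnP (fun i : 'I_s => val i) aT.
have uT : u \in T := uT'.
have inT i : i \in T -> (0 < set_mnm (v |: T) i)%N.
  by move=> iT; rewrite set_mnmE in_setU1 iT orbT.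
case: p pT => [|p] pT; first by apply: rel_exact0 uT (inT _ uT).
have cT : #|T| = #|T :\ u|.+1 by rewrite (cardsD1 u) uT.
have [w] : exists w, w \in T :\ u.
  by apply/set0Pn; rewrite -card_gt0 -ltnS -cT (leq_trans _ pT).
rewrite !inE => /andP [wu wT].
have uw : (u < w)%N.
  by rewrite ltn_neqAle eq_sym (inj_eq val_inj) wu; apply: umin.
have vNT : v \notin T by apply/negP => /Tv; rewrite ltnn.
rewrite -{1}(setD1K uT); apply: rel_exact_chase.
- by rewrite setD11.
- exact: inT.
- apply: rel_exact_nonface.
    by apply/subsetP => i; rewrite !inE => /andP [_ ->]; rewrite orbT.
  rewrite path_face_set negbK; apply/exists_inP; exists u.
    by rewrite !inE eqxx uT orbT.
  apply/exists_inP; exists v; last exact: leq_ltn_trans uw (Tv _ wT).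
  by rewrite !inE eqxx (negbTE vNT) andbF.
rewrite set_mnm_subU; have -> : (v |: T) :\ u = v |: (T :\ u).
  apply/setP => i; rewrite !inE; have [->|//] := eqVneq i u.
  by rewrite orbF; apply/esym/eqP => uv; rewrite -uv uT in vNT.
apply: IH; [by rewrite -ltnS -cT| |by rewrite -ltnS -cT].
by move=> i; rewrite !inE => /andP [_ /Tv].
Qed.

(** Remove v = max A: one term is [rel_exact_setU1], the other is the same statement for A - v and p
    - 1. *)
Lemma rel_exact_full A p : (p.+2 <= #|A|)%N -> rel_exact A (set_mnm A) p.
Proof.
elim: p A => [|p IH] A pA.
  have [a aA] : exists a, a \in A by apply/set0Pn; rewrite -card_gt0 (leq_trans _ pA).
  by apply: (rel_exact0 aA); rewrite set_mnmE aA.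
have A0 : A != set0 by rewrite -card_gt0 (leq_trans _ pA).
have [v vA vmax] := set_max A0.
have cA : #|A| = #|A :\ v|.+1 by rewrite (cardsD1 v) vA.
rewrite -{1}(setD1K vA); apply: rel_exact_chase.
- by rewrite setD11.
- by rewrite set_mnmE vA.
- rewrite -{2}(setD1K vA); apply: rel_exact_setU1 => //.
  by rewrite -ltnS -cA.
by rewrite set_mnm_subU; apply: IH; rewrite -ltnS -cA.
Qed.

(** Squarefreeness is [no_gen_ge2]; the lower bound on the degree is [gen_mdeg], and the upper bound
    comes from [rel_exact_full] through [no_gen]. *)
Lemma gen_deg p (e : gen p.+1) :
  exists2 A : {set 'I_s}, #|A| = p.+2 & gdeg e = set_mnm A.
Proof.
pose A := [set j | 0 < gdeg e j]%N.
have eA : gdeg e = set_mnm A.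
  apply/mnmP => j; rewrite set_mnmE inE.
  by have := no_gen_ge2 (@path_faceS s) e j; case: (gdeg e j) => [|[|]].
exists A => //; apply/eqP; rewrite eqn_leq.
have := gen_mdeg (@path_face_mdeg1 s) e; rewrite eA mdeg_set_mnm => ->.
rewrite andbT leqNgt; apply/negP => pA.
apply: (no_gen (b := set_mnm A) _ eA).
have -> : [set j | 0 < set_mnm A j]%N = A.
  by apply/setP => j; rewrite inE set_mnmE lt0b.
exact: rel_exact_full.
Qed.

Lemma gen_count p A : #|A| = p.+2 ->
  #|[set e : gen p.+1 | gdeg e == set_mnm A]| = gap A.
Proof.
(* The cutoff is harmless: a generator of F_(s+2) has total degree at least s + 3, too large to
   divide a squarefree monomial. *)
pose n A : int := \sum_(p < s.+2) (-1) ^+ p *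
  (#|[set e : gen p | gdeg e == set_mnm A]|)%:R.
have degE p' (e : gen p') : exists B, gdeg e = set_mnm B.
  case: p' e => [|p'] e; last by have [B _ ->] := gen_deg e; exists B.
  exists set0; rewrite gdeg0; apply/mnmP => i.
  by rewrite set_mnmE mnm0E inE.
have sum_n (B : {set 'I_s}) : \sum_(C : {set 'I_s} | C \subset B) n C
    = (path_face (set_mnm B))%:R.
  rewrite -(euler_below (@path_faceS s) (G := G) (N := s.+2)); last first.
    move=> e; apply/negP => /mnm_lepP le.
    have := gen_mdeg (@path_face_mdeg1 s) e; rewrite leqNgt ltnS => /negP [].
    apply: leq_trans (_ : mdeg (set_mnm B) <= _)%N.
      by rewrite !mdegE; apply: leq_sum => i _; apply: le.
    rewrite mdeg_set_mnm; apply: leq_trans (max_card _) _.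
    by rewrite card_ord -addn2 leq_addr.
  rewrite exchange_big; apply: eq_bigr => q _ /=.
  rewrite -mulr_sumr -natr_sum; congr (_ * _%:R).
  have suppE (e : gen q) C :
      ([set j | 0 < gdeg e j]%N == C) = (gdeg e == set_mnm C).
    have [D ->] := degE _ e; rewrite (inj_eq (@set_mnm_inj s)).
    by congr (_ == _); apply/setP => j; rewrite inE set_mnmE lt0b.
  rewrite -[RHS]sum1dep_card (partition_big (fun e => [set j | 0 < gdeg e j]%N)
    (fun C => C \subset B)) /= => [|e le].
    apply: eq_bigr => C CB; rewrite -sum1dep_card; apply: eq_bigl => e.
    by rewrite suppE; case: eqP => [->|]; rewrite ?andbF // set_mnm_le CB.
  rewrite -set_mnm_le.
  suff <- : gdeg e = set_mnm [set j | (0 < gdeg e j)%N] by [].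
  by apply/eqP; rewrite -suppE.
(* Moebius inversion: equal sums over all subsets force equal values, by induction on
   cardinality. *)
have nE (B : {set 'I_s}) : n B = kappa B.
  move: {2}#|B| (leqnn #|B|) => m; elim: m B => [|m IH] B Bm.
    have -> : B = set0 by apply/eqP; rewrite -cards_eq0 -leqn0.
    have := sum_n set0; rewrite -sum_kappa !(big_pred1 set0) // => C; exact: subset0.
  have := sum_n B; rewrite -sum_kappa (bigD1 B) //= [in RHS](bigD1 B) //=.
  suff -> : \sum_(C : {set 'I_s} | (C \subset B) && (C != B)) n C =
     \sum_(C : {set 'I_s} | (C \subset B) && (C != B)) kappa C by move/addIr.
  apply: eq_bigr => C; rewrite andbC -properEneq => /proper_card CB.
  by apply: IH; rewrite -ltnS (leq_trans CB).
move=> Ap; have := nE A; rewrite /n /kappa.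
have -> : (A == set0) = false by rewrite -cards_eq0 Ap.
have ps : (p.+1 < s.+2)%N.
  by have := max_card A; rewrite Ap card_ord => h; rewrite !ltnS ltnW // ltnW.
(* By linearity only F_(p+1) has generators of degree t^A, and (-1)^(p+1) is the sign in [kappa A]
   since |A| + 1 = p + 3. *)
rewrite (bigD1 (Ordinal ps)) //= [X in _ + X]big1 => [|[q qs] qp /=].
  rewrite addr0 add0r Ap !exprS !mulN1r opprK => /eqP.
  by rewrite !mulNr eqr_opp (inj_eq (can_inj (signrMK _))) eqr_nat => /eqP.
rewrite eq_card0 ?mulr0 // => e; rewrite inE; apply/negP => /eqP eA.
case: q e eA qs qp => [|q] e eA qs qp.
  move: Ap; rewrite -mdeg_set_mnm -eA gdeg0 mdeg0 //.
have [B Bq] := gen_deg e; rewrite eA => /set_mnm_inj AB.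
by case/eqP: qp; apply: val_inj; move: Bq; rewrite -AB Ap => -[pq] /=; rewrite pq.
Qed.

End PathFrame.

(** * From graded resolutions to frames *)

Lemma mcoeffMZX (k : comNzRingType) n (p : {mpoly k[n]}) (c : k)
    (m b : 'X_{1..n}) :
  (p * (c *: 'X_[m]))@_b = if (m <= b)%MM then p@_(b - m) * c else 0.
Proof.
rewrite -scalerAr mcoeffZ mulrC; case: ifP => [mb|nmb].
  by rewrite -{1}(submK mb) addmC mcoeffMX.
suff -> : (p * 'X_[m])@_b = 0 by rewrite mul0r.
apply/eqP; rewrite mcoeff_eq0 (perm_mem (msuppMX _ _)).
apply/negP => /mapP [c' _ bE]; by rewrite bE lem_addr in nmb.
Qed.

(** * Isomorphism of graded free modules from equal numbers of generators *)

Section GradedIso.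
Variables (k : fieldType) (n : nat).
Local Notation Q := {mpoly k[n]}.

Definition gf_reindex (F G : gfree n) (h : gf_idx G -> gf_idx F) (v : gf_mod k F) :
  gf_mod k G := [ffun t => v (h t)].

Fact gf_reindex_linear F G h : linear (@gf_reindex F G h).
Proof. by move=> a u v; apply/ffunP => t; rewrite !ffunE. Qed.

HB.instance Definition _ F G h := GRing.isLinear.Build Q (gf_mod k F)
  (gf_mod k G) *:%R (@gf_reindex F G h) (@gf_reindex_linear F G h).

End GradedIso.

(** The r-th element of a fiber of [f] is sent to the r-th element of the fiber of [g] over the same
    point. *)
Lemma fiber_injection (I J : finType) (X : eqType) (f : I -> X) (g : J -> X) :
  (forall x, #|[pred i | f i == x]| <= #|[pred j | g j == x]|)%N ->
  exists2 h : I -> J, injective h & forall i, g (h i) = f i.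
Proof.
move=> le.
pose P i j := (g j == f i) && (index j (enum [pred j | g j == f i])
  == index i (enum [pred i' | f i' == f i])).
have [i|h hP] := @fin_all_exists I (fun=> J) P.
  rewrite /P; set r := index i _; set t := enum [pred j | g j == f i].
  have rt : (r < size t)%N.
    rewrite -cardE; apply: leq_trans (le (f i)).
    by rewrite cardE index_mem mem_enum inE.
  have [j j0] : exists j : J, True.
    by case: t rt => [//|j t] _; exists j.
  exists (nth j t r); rewrite index_uniq ?enum_uniq // eqxx andbT.
  by have := mem_nth j rt; rewrite mem_enum inE.
exists h => [i i' hh|i]; last by have /andP [/eqP] := hP i.
have /andP [/eqP gi /eqP ni] := hP i; have /andP [/eqP gi' /eqP ni'] := hP i'.
have ff : f i' = f i by rewrite -gi' -hh gi.
have := ni'; rewrite -hh ff ni => E.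
have mi : i \in enum [pred i0 | f i0 == f i] by rewrite mem_enum inE.
have mi' : i' \in enum [pred i0 | f i0 == f i] by rewrite mem_enum inE ff.
by rewrite -(nth_index i mi) E (nth_index i mi').
Qed.

Lemma gf_iso_fibers (k : fieldType) n (F G : gfree n) :
  (forall b, #|[set e : gf_idx F | gf_deg e == b]|
    = #|[set e : gf_idx G | gf_deg e == b]|) -> gf_iso k F G.
Proof.
move=> FG.
have cE (H : gfree n) b : #|[pred e : gf_idx H | gf_deg e == b]|
    = #|[set e : gf_idx H | gf_deg e == b]| by rewrite cardsE.
have [|h hI hd] := @fiber_injection _ _ _ (@gf_deg n F) (@gf_deg n G).
  by move=> b; rewrite !cE FG.
have [|h2 h2I _] := @fiber_injection _ _ _ (@gf_deg n G) (@gf_deg n F).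
  by move=> b; rewrite !cE FG.
have [h' hK h'K] := inj_card_bij hI (leq_card _ h2I).
exists (@gf_reindex k n F G h').
  exists (@gf_reindex k n G F h) => v; apply/ffunP => e; rewrite !ffunE.
    by rewrite hK.
  by rewrite h'K.
move=> b v; split=> H e c; last by have := H (h e) c; rewrite ffunE hK hd.
by rewrite ffunE => /H; rewrite -[in gf_deg e](h'K e) hd.
Qed.

(** * J as a monomial ideal *)

Section QuotientByPathIdeal.
Variables (k : fieldType) (s : nat).
Local Notation Q := {mpoly k[s]}.
Local Notation proj := (@quot_proj Q (@J_generator k s)).

Lemma quot_projZ (a p : Q) : a *: (proj p : QJ k s) = proj (a * p).
Proof. exact: quot_scaleE. Qed.

Lemma quot_proj0 : proj 0 = 0 :> QJ k s.
Proof. by rewrite -[0 in LHS](mul0r 0) -quot_projZ scale0r. Qed.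

Lemma quot_proj_sum (I : finType) (P : pred I) (p : I -> Q) :
  \sum_(i | P i) (proj (p i) : QJ k s) = proj (\sum_(i | P i) p i).
Proof.
by symmetry; apply: (big_morph (fun p => proj p : QJ k s)); [exact: quot_projD|exact: quot_proj0].
Qed.

Lemma mem_path_ideal (p : Q) :
  reflect (forall m, m \in msupp p -> ~~ path_face m)
    ((p : Q^o) \in ideal_gen (@J_generator k s)).
Proof.
apply: (iffP (boolp.asboolP _)).
  case=> r [c [g [gJ ->]]] m; rewrite mcoeff_msupp raddf_sum /= => /sum_neq0 [i].
  have [a [b [ab ->]]] := gJ i.
  rewrite -mpolyXD -[X in c i * X]scale1r mcoeffMZX; case: ifP; rewrite ?eqxx //.
  move=> /mnm_lepP le _; apply/negP => /path_faceP /(_ a b ab).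
  have := le a; have := le b; rewrite !mnmDE !mnm1E !eqxx addn1 add1n => hb ha.
  by apply; [apply: leq_ltn_trans ha|apply: leq_ltn_trans hb].
move=> h; apply/boolp.asboolP.
have [cl0 cl] := ideal_gen_closed (@J_generator k s).
rewrite [p]mpolyE big_seq.
apply: (@big_ind Q (fun q => (q : Q^o) \in ideal_gen (@J_generator k s))) => //.
  by move=> q r qJ rJ; rewrite -[q : Q^o](scale1r (q : Q^o)); apply: cl.
move=> m /h; rewrite negbK => /existsP [a /existsP [b /and3P [ab ma mb]]].
(* A monomial outside the faces is divisible by some generator t_a t_b; the cofactor is the
   quotient. *)
apply/boolp.asboolP; exists 1%N, (fun=> p@_m *: 'X_[m - (U_(a) + U_(b))]).
exists (fun=> 'X_a * 'X_b); split=> [_|]; first by exists a, b.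
rewrite big_ord1 -scalerAl -!mpolyXD submK //; apply/mnm_lepP => i.
rewrite mnmDE !mnm1E; case: eqP => [<-|_]; last by case: eqP => [<-|].
by case: eqP => // ba; rewrite ba ltnNge leqnSn in ab.
Qed.

Lemma proj_monomial_eq0 (c : k) (b : 'X_{1..s}) :
  proj (c *: 'X_[b]) = 0 :> QJ k s <-> (path_face b -> c = 0).
Proof.
rewrite -quot_proj0 quot_projE subr0; split=> [/mem_path_ideal h fb|h].
  apply/eqP; apply: contraTT fb => c0; apply: h.
  by rewrite mcoeff_msupp mcoeffZ mcoeffX eqxx mulr1.
apply/mem_path_ideal => m; rewrite mcoeff_msupp mcoeffZ mcoeffX.
have [<-|_] := eqVneq b m; last by rewrite mulr0 eqxx.
by rewrite mulr1; apply: contra => fb; rewrite h.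
Qed.

End QuotientByPathIdeal.

(** * The scalar matrices of a minimal resolution *)

Section ResolutionFrame.
Variables (k : fieldType) (s : nat) (F : gresolution (@QJ_homog k s)).
Hypothesis Fmin : minimal_resolution F.
Local Notation Q := {mpoly k[s]}.
Local Notation M p := (gf_mod k (res_mod F p)).
Local Notation E p := (gf_idx (res_mod F p)).
Local Notation proj := (@quot_proj Q (@J_generator k s)).

Let deg p (e : E p) : 'X_{1..s} := gf_deg e.

Let basis p (e : E p) : M p := [ffun e' => (e' == e)%:R].

(* The scalar c in the component c t^(b - deg e) of w at the generator e. *)
Let comp (b : 'X_{1..s}) p (w : M p) (e : E p) : k :=
  if (deg e <= b)%MM then (w e : Q)@_(b - deg e) else 0.

Let scoef p (e : E p.+1) (e' : E p) : k := comp (deg e) (res_d F p (basis e)) e'.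

Let homogenize (b : 'X_{1..s}) p (v : E p -> k) : M p :=
  [ffun e => v e *: 'X_[b - deg e]].

Lemma gf_sum_at (H : gfree s) (I : finType) (x : I -> Q)
    (v : I -> gf_mod k H) e :
  (\sum_i x i *: v i) e = \sum_i x i * (v i e : Q) :> Q.
Proof. by rewrite sum_ffunE; apply: eq_bigr => i _; exact: ffunE. Qed.

Lemma basis_at p (e e' : E p) : basis e e' = (e' == e)%:R :> Q.
Proof. exact: ffunE. Qed.

Lemma homogenize_at b p (v : E p -> k) e :
  homogenize b v e = v e *: 'X_[b - deg e] :> Q.
Proof. exact: ffunE. Qed.

Lemma basisE p (w : M p) : w = \sum_e (w e : Q) *: basis e.
Proof.
apply/ffunP => e; rewrite [RHS]gf_sum_at (bigD1 e) //= basis_at eqxx mulr1.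
rewrite big1 ?addr0 // => i /negbTE ie.
by rewrite basis_at eq_sym ie mulr0.
Qed.

Lemma basis_homog p (e : E p) : gf_homog (deg e) (basis e).
Proof.
move=> e' c; rewrite basis_at; have [->|_] := eqVneq e' e; last by rewrite msupp0.
by rewrite msupp1 inE => /eqP ->; rewrite add0m.
Qed.

Lemma homog_homogenize b p (w : M p) : gf_homog b w -> w = homogenize b (comp b w).
Proof.
move=> hw; apply/ffunP => e; rewrite homogenize_at; apply/mpolyP => m.
rewrite mcoeffZ mcoeffX /comp; have [me|nme] := eqVneq (m + deg e)%MM b.
  by rewrite -me lem_addl addmK eqxx mulr1.
have -> : (w e : Q)@_m = 0.
  by apply/eqP; rewrite mcoeff_eq0; apply/negP => /hw /eqP; rewrite (negbTE nme).
case: ifP => [eb|_]; last by rewrite mul0r.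
case: eqP => [mE|_]; last by rewrite mulr0.
by rewrite -mE submK ?eqxx in nme.
Qed.

Lemma d_basis p (e : E p.+1) :
  res_d F p (basis e) = homogenize (deg e) (scoef e).
Proof. exact/homog_homogenize/res_d_homog/basis_homog. Qed.

(** By homogeneity each entry of the differential is a scalar times t^(deg e - deg e'), so the same
    scalar matrix acts in every degree b. This is what reduces a resolution to a [frame]. *)
Lemma comp_d b p (w : M p.+1) (e' : E p) :
  comp b (res_d F p w) e' = \sum_e comp b w e * scoef e e'.
Proof.
have -> : res_d F p w = \sum_e (w e : Q) *: homogenize (deg e) (scoef e).
  rewrite {1}[w]basisE linear_sum; apply: eq_bigr => e _.
  by rewrite linearZ /= d_basis.
rewrite /comp gf_sum_at raddf_sum /=.
transitivity (\sum_e if (deg e' <= b)%MM then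
    (w e * (scoef e e' *: 'X_[deg e - deg e']) : Q)@_(b - deg e') else 0).
  by case: ifP => _; [apply: eq_bigr => e _; rewrite homogenize_at|rewrite big1].
apply: eq_bigr => e _; rewrite mcoeffMZX.
have [->|] := eqVneq (scoef e e') 0; first by rewrite !mulr0 !if_same.
rewrite {1}/scoef {1}/comp; case: ifP => [e'e _|]; last by rewrite eqxx.
have [eb|neb] := boolP (deg e <= b)%MM.
  rewrite (lepm_trans e'e eb); have -> : (deg e - deg e' <= b - deg e')%MM.
    by apply/mnm_lepP => i; rewrite !mnmBE leq_sub2r //; move/mnm_lepP: eb.
  congr (_@__ * _); apply/mnmP => i; rewrite !mnmBE subnBA; last by move/mnm_lepP: e'e.
  by rewrite subnK //; apply: leq_trans (_ : deg e i <= _)%N; move/mnm_lepP: e'e eb => // _ /mnm_lepP.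
rewrite mul0r; case: ifP => // e'b; case: ifP => // le; case/negP: neb.
rewrite -(submK e'e) -(submK e'b); apply/mnm_lepP => i; rewrite !mnmDE leq_add2r.
by move/mnm_lepP: le.
Qed.

Lemma comp_homogenize b c p (v : E p -> k) e :
  (forall e, v e != 0 -> (deg e <= b)%MM) ->
  comp c (homogenize b v) e = if c == b then v e else 0.
Proof.
move=> vb; rewrite /comp homogenize_at mcoeffZ mcoeffX.
have [->|/vb eb] := eqVneq (v e) 0; first by rewrite mul0r !if_same.
have [->|cb] := eqVneq c b; first by rewrite eb eqxx mulr1.
case: ifP => // ec; case: eqP => [E|_]; last by rewrite mulr0.
by rewrite -(submK ec) -E submK ?eqxx in cb.
Qed.

Lemma comp_inj p (w : M p) : (forall b e, comp b w e = 0) -> w = 0.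
Proof.
move=> h; apply/ffunP => e; rewrite ffunE; apply/mpolyP => m; rewrite mcoeff0.
by have := h (m + deg e)%MM e; rewrite /comp lem_addl addmK.
Qed.

Lemma comp_supp b p (w : M p) e : comp b w e != 0 -> (deg e <= b)%MM.
Proof. by rewrite /comp; case: ifP; rewrite ?eqxx. Qed.

Lemma scoef_supp p (e : E p.+1) e' : scoef e e' != 0 -> (deg e' <= deg e)%MM.
Proof. exact: comp_supp. Qed.

Lemma res_dd p (w : M p.+2) : res_d F p (res_d F p.+1 w) = 0.
Proof. by apply/res_exact; exists w. Qed.

Lemma res_aug_d (w : M 1) : res_aug F (res_d F 0 w) = 0.
Proof. by apply/res_exact0; exists w. Qed.

(** For equal degrees [scoef] is the constant coefficient of an entry that minimality puts in (t_1,
    ..., t_s). *)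
Lemma scoef_lt p (e : E p.+1) (e' : E p) : scoef e e' != 0 ->
  (deg e' <= deg e)%MM && (deg e' != deg e).
Proof.
move=> ne; rewrite (scoef_supp ne) /=; apply: contra ne => /eqP ee.
have [w wE] := Fmin (basis e).
have dd : (deg e - deg e = 0)%MM by apply/mnmP => j; rewrite mnmBE mnm0E subnn.
rewrite /scoef /comp ee lepm_refl dd wE gf_sum_at raddf_sum /= big1 // => i _.
rewrite mulrC -['X_i]scale1r mcoeffMZX.
case: ifP => // /mnm_lepP /(_ i).
by rewrite mnm1E eqxx mnm0E.
Qed.

Lemma scoef_scoef p (e : E p.+2) (e2 : E p) :
  \sum_e1 scoef e e1 * scoef e1 e2 = 0.
Proof. by rewrite -comp_d res_dd /comp ffunE mcoeff0 if_same. Qed.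

Lemma scoef_exact p (b : 'X_{1..s}) (v : E p.+1 -> k) :
  (forall e, v e != 0 -> (deg e <= b)%MM) ->
  (forall e', \sum_e v e * scoef e e' = 0) ->
  exists2 w : E p.+2 -> k, (forall e, w e != 0 -> (deg e <= b)%MM) &
    forall e, v e = \sum_e1 w e1 * scoef e1 e.
Proof.
move=> vb dv; have : res_d F p (homogenize b v) = 0.
  apply: comp_inj => c e'; rewrite comp_d; have [->|cb] := eqVneq c b.
    by rewrite -[RHS](dv e'); apply: eq_bigr => e _; rewrite comp_homogenize // eqxx.
  by rewrite big1 // => e _; rewrite comp_homogenize // (negbTE cb) mul0r.
move/res_exact => [w dw]; exists (comp b w) => [e|e]; first exact: comp_supp.
by rewrite -comp_d dw comp_homogenize // eqxx.
Qed.

Variable a : E 0 -> k.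
Hypothesis aE : forall e, res_aug F (basis e) = proj (a e *: 'X_[deg e]).

Lemma res_augE (w : M 0) :
  res_aug F w = proj (\sum_e (w e : Q) * (a e *: 'X_[deg e])).
Proof.
rewrite [w in LHS]basisE linear_sum -quot_proj_sum; apply: eq_bigr => e _.
by rewrite linearZ /= aE quot_projZ.
Qed.

Lemma aug_homogenize b (v : E 0 -> k) : (forall e, v e != 0 -> (deg e <= b)%MM) ->
  res_aug F (homogenize b v) = proj ((\sum_e v e * a e) *: 'X_[b]).
Proof.
move=> vb; rewrite res_augE scaler_suml; congr proj; apply: eq_bigr => e _.
rewrite homogenize_at -scalerAl -scalerAr scalerA -mpolyXD.
by have [->|/vb eb] := eqVneq (v e) 0; [rewrite mul0r !scale0r|rewrite submK].
Qed.

Lemma scoef_augc (e : E 1) : path_face (deg e) ->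
  \sum_e1 scoef e e1 * a e1 = 0.
Proof.
apply/proj_monomial_eq0; rewrite -aug_homogenize; last exact: scoef_supp.
by rewrite -d_basis res_aug_d.
Qed.

Lemma scoef_aug_exact (b : 'X_{1..s}) (v : E 0 -> k) :
  (forall e, v e != 0 -> (deg e <= b)%MM) ->
  (path_face b -> \sum_e v e * a e = 0) ->
  exists2 w : E 1 -> k, (forall e, w e != 0 -> (deg e <= b)%MM) &
    forall e, v e = \sum_e1 w e1 * scoef e1 e.
Proof.
move=> vb /proj_monomial_eq0; rewrite -aug_homogenize // => /res_exact0 [w dw].
exists (comp b w) => [e|e]; first exact: comp_supp.
by rewrite -comp_d dw comp_homogenize // eqxx.
Qed.

(** The component of degree 0 of a lift of 1 suffices, because no element of J has a constant
    term. *)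
Lemma scoef_aug_surj :
  exists2 f : E 0 -> k, (forall e, f e != 0 -> deg e = 0%MM) &
    \sum_e f e * a e = 1.
Proof.
have [w] := res_aug_surj F (proj 1).
rewrite res_augE => /quot_projE /mem_path_ideal /(_ 0%MM) h.
exists (comp 0%MM w) => [e /comp_supp /mnm_lepP le|].
  by apply/mnmP => i; apply/eqP; rewrite mnm0E -leqn0; have := le i; rewrite mnm0E.
have compE : \sum_e comp 0%MM w e * a e
    = (\sum_e (w e : Q) * (a e *: 'X_[deg e]))@_0%MM.
  rewrite raddf_sum; apply: eq_bigr => e _; rewrite /= mcoeffMZX /comp.
  by case: ifP; rewrite ?mul0r.
apply/eqP; rewrite -subr_eq0 compE; apply/negPn/negP => ne.
have : ~~ path_face (0%MM : 'X_{1..s}).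
  by apply: h; rewrite mcoeff_msupp mcoeffB mcoeff1 eqxx.
by rewrite path_face_mdeg1 // mdeg0.
Qed.

Definition resolution_frame : frame k (@path_face s) :=
  Frame scoef_lt scoef_scoef scoef_augc scoef_exact scoef_aug_exact scoef_aug_surj.

End ResolutionFrame.

Section MinimalResolution.
Variables (k : fieldType) (s : nat) (F : gresolution (@QJ_homog k s)).
Hypothesis Fmin : minimal_resolution F.

Lemma resolution_is_frame : exists G : frame k (@path_face s),
  forall p b, #|[set e : gf_idx (res_mod F p) | gf_deg e == b]|
    = #|[set e : gen G p | gdeg e == b]|.
Proof.
(* The image of a basis element is homogeneous, so it is the class of a scalar multiple of one
   monomial; these scalars form the augmentation of the frame. *)
have [e|a aE] := @fin_all_exists (gf_idx (res_mod F 0)) (fun=> k)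
  (fun e c => res_aug F [ffun e' => (e' == e)%:R]
     = quot_proj (@J_generator k s) (c *: 'X_[gf_deg e])).
  have [p pE ->] := res_aug_homog (basis_homog (e := e)).
  exists p@_(gf_deg e); congr quot_proj; apply/mpolyP => m.
  rewrite mcoeffZ mcoeffX; have [->|nm] := eqVneq; first by rewrite mulr1.
  rewrite mulr0; apply/eqP; rewrite mcoeff_eq0; apply/negP => /pE /eqP.
  by rewrite eq_sym (negbTE nm).
by exists (resolution_frame Fmin aE).
Qed.

Lemma resolution_deg p (e : gf_idx (res_mod F p.+1)) :
  exists2 A : {set 'I_s}, #|A| = p.+2 & gf_deg e = set_mnm A.
Proof.
have [G GE] := resolution_is_frame.
have : (0 < #|[set e' : gen G p.+1 | gdeg e' == gf_deg e]|)%N.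
  by rewrite -GE; apply/card_gt0P; exists e; rewrite inE.
by case/card_gt0P => e'; rewrite inE => /eqP <-; apply: gen_deg.
Qed.

Lemma resolution_count p (A : {set 'I_s}) : #|A| = p.+2 ->
  #|[set e : gf_idx (res_mod F p.+1) | gf_deg e == set_mnm A]| = gap A.
Proof.
by move=> cA; have [G ->] := resolution_is_frame; apply: gen_count.
Qed.

Lemma resolution_iso i : (2 <= i)%N ->
  gf_iso k (res_mod F i.-1)
    (gf_sum (fun A : {A : {set 'I_s} | #|A| == i} =>
       gf_pow (gf_twist (set_mnm (val A))) (gap (val A)))).
Proof.
case: i => [|[|p]] // _; apply: gf_iso_fibers => b.
pose I := {A : {set 'I_s} | #|A| == p.+2}.
(* At most one A contributes, as [set_mnm] is injective; with no such A, neither module has a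
   generator of degree b. *)
transitivity (\sum_(A : I | set_mnm (val A) == b) gap (val A))%N.
  have [A /eqP bA|nA] := pickP (fun A : I => set_mnm (val A) == b).
    rewrite (big_pred1 A) => [|B]; last first.
      by rewrite -bA (inj_eq (@set_mnm_inj s)) (inj_eq val_inj).
    by rewrite -bA resolution_count //; apply/eqP/(valP A).
  rewrite big_pred0 //; apply: eq_card0 => e; rewrite inE; apply/negP => /eqP eb.
  have [A cA eA] := resolution_deg e.
  by have := nA (Sub A (introT eqP cA)); rewrite /= -eA eb eqxx.
symmetry; rewrite -sum1dep_card.
transitivity (\sum_(A : I | set_mnm (val A) == b)
    \sum_(l : {_ : 'I_(gap (val A)) & unit}) 1)%N.
  by rewrite sig_big_dep; apply: eq_bigl => e; rewrite andbT.
apply: eq_bigr => A _; rewrite sum1_card.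
by rewrite card_tagged sumnE big_map big_enum /= sum_nat_const card_unit muln1 card_ord.
Qed.

End MinimalResolution.

(** * Hilbert series *)

Lemma fps_mul_inj (R : comUnitRingType) (f g h : fps R) :
  f 0%N \is a GRing.unit -> fps_mul f g =1 fps_mul f h -> g =1 h.
Proof.
move=> uf gh m; elim/ltn_ind: m => m IH.
have := gh m; rewrite /fps_mul !big_ord_recl /= subn0.
have -> : \sum_(i < m) f (bump 0 i) * g (m - bump 0 i)%N
    = \sum_(i < m) f (bump 0 i) * h (m - bump 0 i)%N.
  apply: eq_bigr => i _; rewrite IH // /bump add1n.
  by rewrite -subn_gt0 subKn ?ltn_ord.
by move/addIr/(mulrI uf).
Qed.

Section HilbertSeries.
Variables (s : nat) (d : 'I_s -> nat).
Hypothesis d_gt0 : forall j, (0 < d j)%N.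
Implicit Types (A B : {set 'I_s}) (c : 'X_{1..s}).

Definition wdeg c := (\sum_(j < s) c j * d j)%N.

(** The search is bounded by total degree m, which loses no monomial of weight m because the weights
    are positive. *)
Definition wmon (m : nat) : seq 'X_{1..s} :=
  [seq bmnm x | x <- enum {: 'X_{1..s < m.+1}} & wdeg (bmnm x) == m].

Definition supp c : {set 'I_s} := [set j | 0 < c j]%N.

Lemma wmon_uniq m : uniq (wmon m).
Proof.
rewrite map_inj_uniq; first exact/filter_uniq/enum_uniq.
by move=> x y; exact: val_inj.
Qed.

Lemma mem_wmon m c : (c \in wmon m) = (wdeg c == m).
Proof.
apply/mapP/idP => [[c' + ->]|/eqP cm]; first by rewrite mem_filter => /andP [].
have cb : (mdeg c < m.+1)%N.
  rewrite ltnS mdegE -cm; apply: leq_sum => j _; exact: leq_pmulr.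
by exists (BMultinom cb); rewrite // mem_filter mem_enum cm eqxx.
Qed.

Lemma wdegD c c' : wdeg (c + c')%MM = (wdeg c + wdeg c')%N.
Proof.
by rewrite /wdeg -big_split; apply: eq_bigr => j _; rewrite mnmDE mulnDl.
Qed.

Lemma wdeg_set B : wdeg (set_mnm B) = (\sum_(j in B) d j)%N.
Proof.
rewrite /wdeg [RHS]big_mkcond; apply: eq_bigr => j _; rewrite set_mnmE.
by case: (j \in B); rewrite ?mul1n.
Qed.

Lemma set_mnm_le_supp B c : (set_mnm B <= c)%MM = (B \subset supp c).
Proof.
apply/mnm_lepP/subsetP => h j.
  by move=> jB; have := h j; rewrite set_mnmE jB inE.
by rewrite set_mnmE; have := h j; rewrite inE; case: (j \in B) => // ->.
Qed.

(** Division by t^B is a bijection onto the monomials of the remaining weight. *)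
Lemma size_wmon_shift m B :
  size [seq c <- wmon m | B \subset supp c]
    = if (wdeg (set_mnm B) <= m)%N then size (wmon (m - wdeg (set_mnm B))) else 0%N.
Proof.
case: ifP => [Bm|nBm].
  rewrite -[RHS](size_map (fun c => c + set_mnm B)%MM); apply/perm_size/uniq_perm.
  - exact/filter_uniq/wmon_uniq.
  - by rewrite map_inj_uniq ?wmon_uniq //; exact: addIm.
  move=> c; rewrite mem_filter mem_wmon -set_mnm_le_supp.
  apply/andP/mapP => [[Bc /eqP cm]|[c' + ->]].
    exists (c - set_mnm B)%MM; last by rewrite submK.
    by rewrite mem_wmon -cm -{2}(submK Bc) wdegD addnK.
  by rewrite mem_wmon lem_addl wdegD => /eqP ->; rewrite subnK.
apply/eqP; rewrite size_filter -leqn0 leqNgt -has_count; apply/hasPn => c.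
rewrite mem_wmon => /eqP cm; rewrite -set_mnm_le_supp; apply: contraFN nBm => Bc.
by rewrite -cm -(submK Bc) wdegD leq_addl.
Qed.

(** The Hilbert series of Q itself. *)
Definition wcount : fps int := fun m => (size (wmon m))%:R.

(** The term of B counts the monomials of weight m divisible by t^B; exchanging the sums groups
    these by monomial. It serves both for the denominator, with a B = (-1)^|B|, and for the
    numerator, with a = [kappa]. *)
Lemma fps_mul_wcount (a : {set 'I_s} -> int) m :
  fps_mul (fps_poly (\sum_B (a B)%:P * 'X^(\sum_(j in B) d j)%N)) wcount m
    = \sum_(c <- wmon m) \sum_(B : {set 'I_s} | B \subset supp c) a B.
Proof.
transitivity (\sum_B a B * (size [seq c <- wmon m | B \subset supp c])%:R); last first.
  under [RHS]eq_bigr do rewrite big_mkcond.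
  rewrite exchange_big; apply: eq_bigr => B _.
  by rewrite -big_mkcond /= -big_filter big_const_seq count_predT iter_addr_0 mulr_natr.
rewrite /fps_mul /fps_poly.
under eq_bigr do rewrite coef_sum mulr_suml.
rewrite exchange_big; apply: eq_bigr => B _ /=.
under eq_bigr do rewrite coefCM coefXn -wdeg_set -mulrA.
rewrite -mulr_sumr size_wmon_shift; congr (_ * _).
case: ifP => [Bm|nBm].
  rewrite -ltnS in Bm; rewrite (bigD1 (Ordinal Bm)) //= eqxx mul1r big1 ?addr0 //.
  by move=> i /eqP ne; case: eqP => [E|_]; [case: ne; apply: val_inj|rewrite mul0r].
rewrite big1 // => i _; case: eqP => [E|_]; last by rewrite mul0r.
by move: nBm (ltn_ord i); rewrite E ltnS => ->.
Qed.

Lemma prod_geometric :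
  \prod_(j < s) (1 - 'X^(d j)) =
    \sum_(B : {set 'I_s}) ((-1) ^+ #|B|)%:P * 'X^(\sum_(j in B) d j)%N :> {poly int}.
Proof.
under eq_bigr do rewrite addrC.
rewrite bigA_distr; apply: eq_bigr => B _.
rewrite -big_mkcond /= prodrN -prodrXr rmorphXn rmorphN1 //.
Qed.

(** For the signs (-1)^|B| the inner sum vanishes unless the support is empty, so only the monomial
    1 survives and the product with [wcount] is 1. *)
Lemma fps_inv_prod :
  fps_inv (fps_poly (\prod_(j < s) (1 - 'X^(d j)))) =1 wcount.
Proof.
have DN : fps_mul (fps_poly (\prod_(j < s) (1 - 'X^(d j)))) wcount =1 fps_poly 1.
  move=> m; rewrite prod_geometric fps_mul_wcount /fps_poly coef1.
  under eq_bigr do rewrite sum_subset_sign.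
  rewrite (eq_bigr (fun c => (c == 0%MM)%:R)) => [|c _]; last first.
    congr (nat_of_bool _)%:R; apply/eqP/eqP => [c0|->].
      apply/mnmP => j; rewrite mnm0E; move/setP/(_ j): c0; rewrite !inE.
      by case: (c j).
    by apply/setP => j; rewrite !inE mnm0E.
  rewrite -natr_sum; congr _%:R; rewrite -big_mkcond sum1_count.
  rewrite (count_uniq_mem _ (wmon_uniq m)) mem_wmon /wdeg big1 1?eq_sym // => j _.
  by rewrite mnm0E.
have u : fps_poly (\prod_(j < s) (1 - 'X^(d j))) 0%N \is a @GRing.unit int.
  apply/unitrPr; exists (wcount 0%N).
  by have := DN 0%N; rewrite /fps_mul big_ord1 /fps_poly coef1.
by apply: (fps_mul_inj u) => m; rewrite fps_mulVf // DN.
Qed.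

Definition facemon m := [seq c <- wmon m | path_face c].

(** By [sum_kappa] the inner sum for the numerator is the indicator of monomials outside J. *)
Lemma hilbert_coef m :
  fps_div
    (fps_poly (1 + \sum_(A : {set 'I_s})
       (-1) ^+ (#|A|.+1) * (gap A)%:R * 'X^(\sum_(j in A) d j)%N)%R)
    (fps_poly (\prod_(j < s) (1 - 'X^(d j)))%R) m = (size (facemon m))%:R :> int.
Proof.
transitivity (fps_mul
    (fps_poly (\sum_B (kappa B)%:P * 'X^(\sum_(j in B) d j)%N)) wcount m).
  rewrite /fps_div /fps_mul; apply: eq_bigr => i _; rewrite fps_inv_prod.
  congr (_ * _); congr (fps_poly _ _).
  under [RHS]eq_bigr do rewrite /kappa polyCD mulrDl.
  rewrite big_split /=; congr (_ + _).
    rewrite (bigD1 set0) //= eqxx big_set0 expr0 mulr1 big1 ?addr0 //.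
    by move=> B /negbTE ->; rewrite mul0r.
  by apply: eq_bigr => B _; rewrite polyCM rmorphXn rmorphN1 rmorph_nat.
rewrite fps_mul_wcount /facemon size_filter -sum1_count natr_sum [RHS]big_mkcond.
apply: eq_bigr => c _; rewrite sum_kappa.
have -> : path_face (set_mnm (supp c)) = path_face c; last by case: (path_face c).
by apply/idP/idP; apply: path_faceS => j; rewrite set_mnmE inE lt0b.
Qed.

(** The monomials outside a monomial ideal form a basis of the quotient. *)
Lemma facemon_kdim (k : fieldType) m :
  has_kdim (@QJ_whomog k s d m) (size (facemon m)).
Proof.
pose mon (i : 'I_(size (facemon m))) := nth 0%MM (facemon m) i.
have memE c : (c \in facemon m) = path_face c && (wdeg c == m).
  by rewrite mem_filter mem_wmon.
have monP i : mon i \in facemon m by apply: mem_nth.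
have mon_inj : injective mon.
  move=> i j /eqP; rewrite nth_uniq ?filter_uniq ?wmon_uniq // => /eqP; exact: val_inj.
pose lc (x : 'I_(size (facemon m)) -> k) : {mpoly k[s]} := \sum_i x i *: 'X_[mon i].
have lcE x i : (lc x)@_(mon i) = x i.
  rewrite raddf_sum /= (bigD1 i) //= mcoeffZ mcoeffX eqxx mulr1 big1 ?addr0 //.
  by move=> j /negbTE ji; rewrite mcoeffZ mcoeffX (inj_eq mon_inj) ji mulr0.
have projE (x : 'I_(size (facemon m)) -> k) :
    \sum_i (x i)%:MP *: (quot_proj (@J_generator k s) 'X_[mon i] : QJ k s)
    = quot_proj (@J_generator k s) (lc x).
  rewrite -quot_proj_sum; apply: eq_bigr => i _.
  by rewrite quot_projZ mul_mpolyC.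
exists (fun i => quot_proj (@J_generator k s) 'X_[mon i]); split.
- move=> i; exists 'X_[mon i] => // c; rewrite msuppX inE => /eqP ->.
  by have := monP i; rewrite memE => /andP [_ /eqP].
- move=> x [p pm ->]; exists (fun i => p@_(mon i)); rewrite projE.
  apply/quot_projE/mem_path_ideal => c; rewrite mcoeff_msupp mcoeffB.
  apply: contraNN => fc; rewrite subr_eq0; apply/eqP.
  have [cm|ncm] := boolP (c \in facemon m).
    have ci : (index c (facemon m) < size (facemon m))%N by rewrite index_mem.
    by have := lcE (fun i => p@_(mon i)) (Ordinal ci); rewrite /mon /= nth_index.
  rewrite raddf_sum big1 /= => [|i _].
    apply/eqP; rewrite mcoeff_eq0; apply: contra ncm => /pm cm.
    by rewrite memE fc /wdeg cm eqxx.
  rewrite mcoeffZ mcoeffX; case: eqP => [E|_]; last by rewrite mulr0.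
  by rewrite -E monP in ncm.
move=> x; rewrite projE -quot_proj0 => /quot_projE; rewrite subr0.
move=> /mem_path_ideal h i; apply/eqP/negPn/negP => ne.
have := h (mon i); rewrite mcoeff_msupp lcE ne => /(_ isT).
by have := monP i; rewrite memE => /andP [->].
Qed.

End HilbertSeries.

Theorem proposition1p4 (k : fieldType) (s : nat) :
  (forall F : gresolution (@QJ_homog k s), minimal_resolution F ->
   forall i : nat, (2 <= i)%N ->
     gf_iso k (res_mod F i.-1)
       (gf_sum (fun A : {A : {set 'I_s} | #|A| == i} =>
          gf_pow (gf_twist (set_mnm (val A))) (gap (val A)))))
  /\
  (forall d : 'I_s -> nat, (forall j, (0 < d j)%N) ->
     is_hilbert_series (@QJ_whomog k s d)
       (fps_div
          (fps_poly (1 + \sum_(A : {set 'I_s})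
             (-1) ^+ (#|A|.+1) * (gap A)%:R * 'X^(\sum_(j in A) d j)%N)%R)
          (fps_poly (\prod_(j < s) (1 - 'X^(d j)))%R))).
Proof.
split=> [F Fmin i i2|d d_gt0 m]; first exact: resolution_iso.
exists (size (facemon d m)); first exact: facemon_kdim.
by rewrite (hilbert_coef d_gt0) natz.
Qed.
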